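(* Let $d\geq1$, $\boldsymbol\mu\in\mathbb{S}^d$, $\rho\in(0,1)$, and let $\boldsymbol X_1,\dots,\boldsymbol X_n$ be iid $\mathrm{C}_1(\boldsymbol\mu,\rho)$. Let $\bar{\boldsymbol X}=n^{-1}\sum_{i=1}^n\boldsymbol X_i$, $$\hat{\boldsymbol\mu}_{\mathrm{MM},1}=\bar{\boldsymbol X}/\|\bar{\boldsymbol X}\|,\qquad\hat\rho_{\mathrm{MM},1}=(d+1)\|\bar{\boldsymbol X}\|.$$ Then (i) $(\hat{\boldsymbol\mu}_{\mathrm{MM},1},\hat\rho_{\mathrm{MM},1})\to(\boldsymbol\mu,\rho)$ almost surely as $n\to\infty$; and (ii) $$\sqrt n\begin{pmatrix}\hat{\boldsymbol\mu}_{\mathrm{MM},1}-\boldsymbol\mu\\ \hat\rho_{\mathrm{MM},1}-\rho\end{pmatrix}\rightsquigarrow\mathcal N_{d+2}\left(\boldsymbol0,\begin{pmatrix}\sigma^2_{\mathrm{MM},1}(\boldsymbol\mu)(\boldsymbol I_{d+1}-\boldsymbol\mu\boldsymbol\mu^\top)&\boldsymbol0\\ \boldsymbol0^\top&\sigma^2_{\mathrm{MM},1}(\rho)\end{pmatrix}\right)$$ in distribution as $n\to\infty$, where $\sigma^2_{\mathrm{MM},1}(\boldsymbol\mu)=(d+1)\rho^{-2}$ and $\sigma^2_{\mathrm{MM},1}(\rho)=d+1-\rho^2$.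
   Context: For $d\geq1$, $\mathbb{S}^d$ is the unit sphere of $\mathbb{R}^{d+1}$ with surface area measure $\sigma_d$ and total area $\omega_d=2\pi^{(d+1)/2}/\Gamma((d+1)/2)$. $\mathrm{C}_1(\boldsymbol\mu,\rho)$ is the distribution on $\mathbb{S}^d$ with density $\omega_d^{-1}\{1+\rho\,\boldsymbol x^\top\boldsymbol\mu\}$ w.r.t. $\sigma_d$. *)

(* Defs.v *)
From HB Require Import structures.
From mathcomp Require Import all_boot all_order all_algebra.
From mathcomp Require Import all_classical all_reals all_analysis.
Set Implicit Arguments. Unset Strict Implicit. Unset Printing Implicit Defensive.
Import Order.TTheory GRing.Theory Num.Theory.
Import numFieldNormedType.Exports.
Local Open Scope classical_set_scope.
Local Open Scope ring_scope.

(** Points of R^n are represented as n-tuples (n.-tuple R carries the product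
    sigma-algebra generated by the coordinate projections, i.e. the Borel
    sigma-algebra of R^n).  For topological statements we move to row vectors. *)

Section Rn.
Context {R : realType} {n : nat}.

Definition tdot (x y : n.-tuple R) : R := \sum_(i < n) tnth x i * tnth y i.
Definition tnorm (x : n.-tuple R) : R := Num.sqrt (tdot x x).
Definition tscale (t : R) (x : n.-tuple R) : n.-tuple R :=
  [tuple t * tnth x i | i < n].
Definition tnormalize (x : n.-tuple R) : n.-tuple R := tscale (tnorm x)^-1 x.
Definition trow (x : n.-tuple R) : 'rV[R]_n := \row_(i < n) tnth x i.

(** lam is Lebesgue measure on R^n: a measure (on the product = Borel
    sigma-algebra) giving every box [a_1,b_1) x ... x [a_n,b_n) its volume.
    Such a measure exists and is unique. *)
Definition is_lebesgue (lam : {measure set (n.-tuple R) -> \bar R}) : Prop :=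
  forall a b : n.-tuple R, (forall i, tnth a i <= tnth b i) ->
    lam [set x | forall i, tnth a i <= tnth x i < tnth b i]
    = (\prod_(i < n) (tnth b i - tnth a i))%:E.
End Rn.

Section sphere.
Context {R : realType} {d : nat}.
Local Notation V := (d.+1.-tuple R).

Definition sphere : set V := [set x | tnorm x = 1].

(** surface area measure sigma_d on S^d, defined through Lebesgue measure on
    R^(d+1) (polar coordinates / cone measure):
    sigma_d(A) = (d+1) * Leb { y : 0 < |y| <= 1, y/|y| in A }. *)
Definition surface_measure (lam : {measure set V -> \bar R}) (A : set V) : \bar R :=
  (d.+1%:R)%:E * lam [set y | ((0 < tnorm y) && (tnorm y <= 1))%R /\ A (tnormalize y)].

Definition sphere_area (lam : {measure set V -> \bar R}) : \bar R :=
  surface_measure lam sphere.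

Definition has_C1_law dT (T : measurableType dT) (P : probability T R)
    (lam : {measure set V -> \bar R}) (mu : V) (rho : R) (X : T -> V) : Prop :=
  forall A : set V, measurable A ->
    P (X @^-1` A) =
    (\int[surface_measure lam]_(x in A `&` sphere)
        ((fine (sphere_area lam))^-1 * (1 + rho * tdot x mu))%:E)%E.
End sphere.

Definition mutually_independent dT dT' (T : measurableType dT)
    (T' : measurableType dT') (R : realType) (P : probability T R)
    (X : nat -> T -> T') : Prop :=
  forall (s : seq nat) (A : nat -> set T'), uniq s ->
    (forall i, measurable (A i)) ->
    P (\big[setI/setT]_(i <- s) (X i @^-1` A i))
    = (\prod_(i <- s) P (X i @^-1` A i))%E.

Definition normal_law {R : realType} (v : R) : set R -> \bar R :=
  fun B => if v == 0 then \d_(0:R) B else normal_prob 0 (Num.sqrt v) B.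

Definition is_gaussian_vector dT (T : measurableType dT) (R : realType)
    (Q : probability T R) (m : nat) (S : 'M[R]_m) (W : T -> 'rV[R]_m) : Prop :=
  forall t : 'rV[R]_m,
    measurable_fun setT (fun w => (W w *m t^T) 0 0) /\
    forall B : set R, measurable B ->
      Q ((fun w => (W w *m t^T) 0 0) @^-1` B) = normal_law ((t *m S *m t^T) 0 0) B.

(** sample mean of X_1, ..., X_n (here indexed X 0, ..., X (n-1)) *)
Definition sample_mean {T : Type} {R : realType} {k : nat}
    (X : nat -> T -> k.-tuple R) (n : nat) (w : T) : k.-tuple R :=
  [tuple (n%:R)^-1 * \sum_(i < n) tnth (X i w) j | j < k].

(* Main.v *)
Require Import Defs.
From HB Require Import structures.
From mathcomp Require Import all_boot all_order all_algebra.
From mathcomp Require Import all_classical all_reals all_analysis.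
From mathcomp Require Import measurable_realfun ring lra.
Import Order.TTheory GRing.Theory Num.Theory.
Import numFieldNormedType.Exports.
Local Open Scope classical_set_scope.
Local Open Scope ring_scope.
Set Implicit Arguments.
Unset Strict Implicit.
Unset Printing Implicit Defensive.

(** With r = rho / (d+1), symmetry of the sphere under signed permutations of the
    coordinates gives E X = r mu and E X X^T = I / (d+1).  A fourth-moment strong
    law then yields Xbar -> r mu almost surely, hence (i).

    For (ii), the map x |-> (x / |x|, |x|) differs from its linearisation at r mu
    by at most C |x - r mu|^2 for every x, so the remainder contributes
    sqrt n * O(1/n) in mean.  Each linear form of the scaled error is thus, up to a
    vanishing term, a normalised sum of bounded iid centred variables, and the
    characteristic function of such a sum converges to the Gaussian one.
    Convergence of characteristic functions passes to bounded continuous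
    functions because, on a cube carrying most of the mass of all the laws,
    these are uniform limits of trigonometric polynomials bounded on the whole
    space. *)

(** * Bounded measurable functions *)

(** The sphere is reached only through Lebesgue measure of cones, and neither its area nor any
    integral over it is computed: odd and off-diagonal moments vanish by sign flips, diagonal second
    moments agree by swaps and add up to the total mass, and a nonzero area is forced by [P] having
    mass one. The law puts [X] on the sphere only almost surely. The estimates therefore use
    truncated coordinates, bounded everywhere and almost surely equal to those of [X], so that
    integrability is automatic. The sample mean may vanish. As the inverse of 0 is 0, the quadratic
    remainder bound holds there too, and no event has to be excluded. The variances come from Cov X
    = I/(d+1) - r^2 mu mu^T, of which mu is an eigenvector: tangential directions give (1/(d+1))/r^2
    = (d+1)/rho^2, the radial one gives (d+1)^2 (1/(d+1) - r^2) = d+1-rho^2, and there is no cross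
    term. Real cosines with an arbitrary phase stand for complex exponentials. *)

Section bounded_measurable_functions.
Context d {T : measurableType d} {R : realType}.
Implicit Types f g : T -> R.

(** This class is closed under all the operations used below and is integrable for every finite
    measure, so linearity and monotonicity of integrals need no further side conditions. *)
Definition bmf f := measurable_fun setT f /\ exists M : R, forall x, `|f x| <= M.

Lemma bmf_cst c : bmf (fun=> c).
Proof. by split; [exact: measurable_cst|exists `|c|]. Qed.

Lemma bmfD f g : bmf f -> bmf g -> bmf (fun x => f x + g x).
Proof.
move=> [mf [M fM]] [mg [N gN]]; split; first exact: measurable_funD.
by exists (M + N) => x; rewrite (le_trans (ler_normD _ _))// lerD.
Qed.

Lemma bmfM f g : bmf f -> bmf g -> bmf (fun x => f x * g x).
Proof.
move=> [mf [M fM]] [mg [N gN]]; split; first exact: measurable_funM.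
by exists (M * N) => x; rewrite normrM ler_pM.
Qed.

Lemma bmfN f : bmf f -> bmf (fun x => - f x).
Proof.
move=> [mf [M fM]]; split; last by exists M => x; rewrite normrN.
exact: measurableT_comp.
Qed.

Lemma bmfB f g : bmf f -> bmf g -> bmf (fun x => f x - g x).
Proof. by move=> bf bg; apply: bmfD => //; exact: bmfN. Qed.

Lemma bmfX f n : bmf f -> bmf (fun x => f x ^+ n).
Proof.
move=> bf; elim: n => [|n ih]; first exact: bmf_cst.
by under eq_fun do rewrite exprS; exact: bmfM.
Qed.

Lemma bmf_norm f : bmf f -> bmf (fun x => `|f x|).
Proof.
move=> [mf [M fM]]; split; last by exists M => x; rewrite normr_id.
exact: measurableT_comp.
Qed.

Lemma bmf_sum (I : Type) (s : seq I) (P : pred I) (F : I -> T -> R) :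
  (forall i, bmf (F i)) -> bmf (fun x => \sum_(i <- s | P i) F i x).
Proof.
move=> bF; elim: s => [|i s ih].
  by under eq_fun do rewrite big_nil; exact: bmf_cst.
under eq_fun do rewrite big_cons; case: (P i) => //; exact: bmfD.
Qed.

Lemma bmf_cos f : measurable_fun setT f -> bmf (fun x => cos (f x)).
Proof.
move=> mf; split; last by exists 1 => x; exact: cos_max.
apply: measurableT_comp => //.
by apply: continuous_measurable_fun; exact: continuous_cos.
Qed.

Lemma bmf_sin f : measurable_fun setT f -> bmf (fun x => sin (f x)).
Proof.
move=> mf; split; last by exists 1 => x; exact: sin_max.
apply: measurableT_comp => //.
by apply: continuous_measurable_fun; exact: continuous_sin.
Qed.

Lemma bmf_indic (A : set T) : measurable A -> bmf (fun x => \1_A x : R).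
Proof.
move=> mA; split; first exact: measurable_indic.
by exists 1 => x; rewrite indicE; case: (x \in A); rewrite ?normr1 ?normr0.
Qed.

End bounded_measurable_functions.

Lemma bmf_comp d (T : measurableType d) (R : realType) d' (T' : measurableType d')
  (f : T' -> R) (X : T -> T') :
  bmf f -> measurable_fun setT X -> bmf (fun x => f (X x)).
Proof.
move=> [mf [M fM]] mX; split; first exact: measurableT_comp.
by exists M => x; exact: fM.
Qed.

Section integral_of_bounded.
Context d {T : measurableType d} {R : realType}.
Variable m : {finite_measure set T -> \bar R}.
Implicit Types f g : T -> R.

Lemma bmf_integrable f : bmf f -> m.-integrable setT (EFin \o f).
Proof.
move=> [mf [M fM]]; apply: measurable_bounded_integrable => //.
  by rewrite ltey_eq fin_num_measure.
exists M; split; first exact: num_real.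
by move=> y My x _ /=; rewrite (le_trans (fM x))// ltW.
Qed.

Lemma bmf_Rint f : bmf f -> (\int[m]_x (f x)%:E = (\int[m]_x f x)%:E)%E.
Proof.
move=> bf; rewrite /Rintegral fineK//.
by apply: integrable_fin_num => //; exact: bmf_integrable.
Qed.

Lemma RintD f g : bmf f -> bmf g ->
  \int[m]_x (f x + g x) = \int[m]_x f x + \int[m]_x g x.
Proof. by move=> bf bg; rewrite RintegralD//; exact: bmf_integrable. Qed.

Lemma RintB f g : bmf f -> bmf g ->
  \int[m]_x (f x - g x) = \int[m]_x f x - \int[m]_x g x.
Proof. by move=> bf bg; rewrite RintegralB//; exact: bmf_integrable. Qed.

Lemma RintZ (c : R) f : bmf f -> \int[m]_x (c * f x) = c * \int[m]_x f x.
Proof. by move=> bf; rewrite RintegralZl//; exact: bmf_integrable. Qed.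

Lemma Rint_sum (I : Type) (s : seq I) (P : pred I) (F : I -> T -> R) :
  (forall i, bmf (F i)) ->
  \int[m]_x (\sum_(i <- s | P i) F i x) = \sum_(i <- s | P i) \int[m]_x F i x.
Proof.
move=> bF; elim: s => [|i s ih].
  rewrite big_nil; under eq_Rintegral do rewrite big_nil.
  by rewrite Rintegral_cst// mul0r.
rewrite big_cons -ih.
under eq_Rintegral do rewrite big_cons.
by case: (P i) => //; rewrite RintD//; exact: bmf_sum.
Qed.

Lemma Rint_le f g : bmf f -> bmf g -> (forall x, f x <= g x) ->
  \int[m]_x f x <= \int[m]_x g x.
Proof.
by move=> bf bg fg; apply: le_Rintegral => //; exact: bmf_integrable.
Qed.

Lemma Rint_norm f : bmf f -> `|\int[m]_x f x| <= \int[m]_x `|f x|.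
Proof. by move=> bf; apply: le_normr_Rintegral => //; exact: bmf_integrable. Qed.

Lemma Rint_dist f g h : bmf f -> bmf g -> bmf h ->
  (forall x, `|f x - g x| <= h x) ->
  `|\int[m]_x f x - \int[m]_x g x| <= \int[m]_x h x.
Proof.
move=> bf bg bh fgh; rewrite -RintB// (le_trans (Rint_norm _))//.
  exact: bmfB.
by apply: Rint_le => //; exact/bmf_norm/bmfB.
Qed.

End integral_of_bounded.

Lemma Rint_prob_cst d (T : measurableType d) (R : realType) (P : probability T R)
  (c : R) : \int[P]_x c = c.
Proof.
rewrite Rintegral_cst//.
by rewrite [X in fine X](@probability_setT _ _ _ P) mulr1.
Qed.

Lemma Rint_prob_le d (T : measurableType d) (R : realType) (P : probability T R)
  (f : T -> R) (c : R) : bmf f -> (forall x, `|f x| <= c) ->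
  `|\int[P]_x f x| <= c.
Proof.
move=> bf fc; rewrite (le_trans (Rint_norm _ bf))//.
rewrite -[leRHS](Rint_prob_cst P); apply: Rint_le => //.
  exact: bmf_norm.
exact: bmf_cst.
Qed.

(** [nu] is dominated by [mu], and [f] agrees almost everywhere with the Radon-Nikodym derivative
    because both have the same integral over every measurable set. It serves the Gaussian density
    and the density on the sphere. *)
Lemma integral_density d (T : measurableType d) (R : realType)
  (mu : {sigma_finite_measure set T -> \bar R})
  (nu : {finite_measure set T -> \bar R}) (f : T -> R) (h : T -> R) :
  measurable_fun setT f ->
  (forall A, measurable A -> nu A = (\int[mu]_(x in A) (f x)%:E)%E) ->
  bmf h ->
  (\int[nu]_x (h x)%:E = \int[mu]_x (h x * f x)%:E)%E.
Proof.
move=> mf nuE bh.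
have dom : nu `<< mu.
  apply/null_content_dominatesP => A mA A0; rewrite nuE//.
  apply: null_set_integral => //; apply: measurable_funTS.
  exact/measurable_EFinP.
rewrite -(Radon_Nikodym_change_of_variables dom)//=; last exact: bmf_integrable.
have mh : measurable_fun setT h by case: bh.
under [RHS]eq_integral do rewrite EFinM.
apply: ae_eq_integral => //.
- apply: emeasurable_funM; first exact/measurable_EFinP.
  by apply: (measurable_int mu); exact: Radon_Nikodym_integrable.
- by apply: emeasurable_funM; exact/measurable_EFinP.
- apply: ae_eqe_mul2l => /=.
  rewrite Radon_NikodymE//=.
  case: cid => /= k [k1 k2 k3].
  apply: integral_ae_eq => //=.
  + exact/measurable_EFinP.
  + by move=> E _ mE; rewrite -k3// -nuE.
Qed.

(** * The Gaussian characteristic function *)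

Section gaussian_characteristic_function.
Context {R : realType}.
Variables (s : R) (b : R).
Hypothesis s0 : s != 0.
Local Notation mu := (@lebesgue_measure R).
Let g : R -> R := normal_pdf 0 s.

Let gE x : g x = normal_peak s * expR (- x ^+ 2 / (s ^+ 2 *+ 2)).
Proof. by rewrite /g (normal_pdfE _ s0)/= /normal_fun subr0. Qed.

Let s2_gt0 : 0 < s ^+ 2. Proof. by rewrite exprn_even_gt0. Qed.

Let g_ge0 x : 0 <= g x. Proof. exact: normal_pdf_ge0. Qed.

Let mg : measurable_fun setT g. Proof. exact: measurable_normal_pdf. Qed.

Let derive_g x : is_derive x (1 : R) g (- x / s ^+ 2 * g x).
Proof.
have -> : g = fun x => normal_peak s *: expR (- x ^+ 2 / (s ^+ 2 *+ 2)).
  by apply/funext => y; rewrite gE.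
apply: is_derive_eq; rewrite /GRing.scale/=.
by field.
Qed.

(** Half of the Gaussian exponent is spent on absorbing [|x|], and the other half is a Gaussian
    density of deviation [s * sqrt 2]. This gives the integrable majorant for differentiating under
    the integral sign. *)
Let xg_le x : `|x * g x| <=
  `|s| * (normal_peak s / normal_peak (s * Num.sqrt 2)) *
  normal_pdf 0 (s * Num.sqrt 2) x.
Proof.
have sq2 : s * Num.sqrt 2 != 0 by rewrite mulf_neq0// gt_eqF// sqrtr_gt0.
have p0 := normal_peak_gt0 s0.
have q0 := normal_peak_gt0 sq2.
rewrite (normal_pdfE _ sq2) /normal_fun subr0 exprMn sqr_sqrtr// gE normrM.
rewrite (ger0_norm (mulr_ge0 _ (expR_ge0 _))); last exact: ltW.
rewrite mulrCA.
set E2 := expR (- x ^+ 2 / (s ^+ 2 * 2 *+ 2)).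
have -> : `|s| * (normal_peak s / normal_peak (s * Num.sqrt 2)) *
    (normal_peak (s * Num.sqrt 2) * E2) = normal_peak s * (`|s| * E2).
  by field; rewrite gt_eqF.
rewrite ler_pM2l// /E2.
set y := x ^+ 2 / (s ^+ 2 * 4).
have -> : - x ^+ 2 / (s ^+ 2 *+ 2) = - y - y.
  by rewrite /y -mulr_natr; field.
have -> : - x ^+ 2 / ((s ^+ 2 * 2) *+ 2) = - y.
  by rewrite /y -mulr_natr; field.
rewrite expRD mulrA ler_pM2r ?expR_gt0//.
(* With z = |x|/|s| one has y = (z/2)^2, and 1 + z^2/4 >= z because (z/2 - 1)^2 >= 0. *)
suff : `|x| / `|s| <= expR y.
  rewrite ler_pdivrMr ?normr_gt0// => h.
  rewrite -[leRHS](mulr1) mulrC expRN.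
  rewrite ler_pdivrMl ?expR_gt0//; first by rewrite mulr1.
apply: le_trans (expR_ge1Dx _).
have -> : y = (`|x| / `|s| / 2) ^+ 2.
  rewrite !expr_div_n !real_normK ?num_real//; rewrite /y; field.
  exact/negP/negP.
by set z := _ / `|s|; have := sqr_ge0 (z / 2 - 1); lra.
Qed.

Let int_xg : mu.-integrable setT (fun x => (`|x * g x|)%:E).
Proof.
apply: (le_integrable measurableT _ _
  (integrableZl measurableT (`|s| * (normal_peak s / normal_peak (s * Num.sqrt 2)))
     (integrable_normal_pdf 0 (s * Num.sqrt 2)))).
  apply/measurable_EFinP; apply: measurableT_comp => //.
  exact: measurable_funM.
move=> x _ /=; rewrite lee_fin normr_id (le_trans (xg_le x))//.
exact: ler_norm.
Qed.

Let F (t : R) (x : R) := cos (t * x + b) * g x.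

Let mlin (t : R) : measurable_fun setT (fun x : R => t * x + b).
Proof.
by apply: measurable_funD => //; exact: measurable_funM.
Qed.

Let int_trig (h : R -> R) : bmf h -> mu.-integrable setT (fun x => (h x * g x)%:E).
Proof.
move=> [mh [M hM]].
apply: (le_integrable measurableT _ _
  (integrableZl measurableT M (integrable_normal_pdf 0 s))).
  apply/measurable_EFinP; exact: measurable_funM.
move=> x _ /=; rewrite lee_fin !normrM ler_wpM2r//.
by rewrite (le_trans (hM x))// ler_norm.
Qed.

Let int_F t : mu.-integrable setT (EFin \o F t).
Proof. by apply: int_trig; exact: bmf_cos. Qed.

Let derF t x : is_derive t (1 : R) (F ^~ x) (- (x * sin (t * x + b) * g x)).
Proof.
have -> : F ^~ x = fun t => g x *: cos (t *: x + b).
  by apply/funext => u; rewrite /F mulrC.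
apply: is_derive_eq; rewrite /GRing.scale/=.
by ring.
Qed.

Let Phi t := \int[mu]_x F t x.

Let derPhi t : is_derive t (1 : R) Phi (- \int[mu]_x (x * sin (t * x + b) * g x)).
Proof.
have tI : `]t - 1, t + 1[%classic t.
  by rewrite /= in_itv/= ltrDl ltrBlDr ltrDl ltr01.
have d1 x y : `]t - 1, t + 1[%classic x -> setT y -> derivable (F ^~ y) x 1.
  by move=> _ _; exact: (@ex_derive _ _ _ _ _ _ _ (derF x y)).
have dv x y : derive1 (F^~ y) x = - (y * sin (x * y + b) * g y).
  by rewrite derive1E; exact: (@derive_val _ _ _ _ _ _ _ (derF x y)).
have ub x y : `]t - 1, t + 1[%classic x -> setT y ->
    `|partial1of2 F x y| <= `|y * g y|.
  move=> _ _; rewrite /partial1of2 dv normrN mulrAC normrM.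
  by rewrite ler_piMr// sin_max.
apply: DeriveDef.
  exact: (derivable_under_integral measurableT tI (fun x _ => int_F x) d1
    (fun y => normr_ge0 _) int_xg ub).
rewrite -derive1E.
rewrite (differentiation_under_integral measurableT tI (fun x _ => int_F x) d1
    (fun y => normr_ge0 _) int_xg ub).
rewrite -mulN1r -RintegralZl//.
  by apply: eq_Rintegral => x _; rewrite /partial1of2 dv mulN1r.
apply: (le_integrable measurableT _ _ int_xg) => /=.
  apply/measurable_EFinP; apply: measurable_funM => //.
  by apply: measurable_funM => //; exact: (bmf_sin (mlin t)).1.
move=> x _; rewrite lee_fin mulrAC normrM normr_id.
by rewrite ler_piMr// sin_max.
Qed.

(** Integration by parts is done through this primitive: its derivative [G'] combines the integrands
    of [Phi] and of the derivative of [Phi], since the density satisfies g' = -x g / s^2. *)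
Let G (t : R) (x : R) := sin (t * x + b) * g x.
Let G' (t : R) (x : R) := t * F t x - (s ^+ 2)^-1 * (x * sin (t * x + b) * g x).

Let derG t x : is_derive x (1 : R) (G t) (G' t x).
Proof.
have -> : G t = fun x => sin (t *: x + b) *: g x by [].
have dg := derive_g x.
apply: is_derive_eq; rewrite /GRing.scale/= /G' /F.
by field.
Qed.

Let int_xsin t : mu.-integrable setT (fun x => (x * sin (t * x + b) * g x)%:E).
Proof.
apply: (le_integrable measurableT _ _ int_xg) => /=.
  apply/measurable_EFinP; apply: measurable_funM => //.
  by apply: measurable_funM => //; exact: (bmf_sin (mlin t)).1.
move=> x _; rewrite lee_fin mulrAC normrM normr_id.
by rewrite ler_piMr// sin_max.
Qed.

Let int_G' t : mu.-integrable setT (EFin \o G' t).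
Proof.
rewrite /G' /comp; under eq_fun do rewrite EFinB !EFinM.
apply: integrableB => //; apply: integrableZl => //; first exact: int_F.
exact: int_xsin.
Qed.

Let contG' t : continuous (G' t).
Proof.
have cg : continuous g.
  by move=> x; apply/differentiable_continuous/derivable1_diffP;
    exact: (@ex_derive _ _ _ _ _ _ _ (derive_g x)).
have cl : continuous (fun x : R => t * x + b).
  move=> x; apply: cvgD; last exact: cvg_cst.
  by apply: cvgM; [exact: cvg_cst|exact: cvg_id].
have cc : continuous (fun x : R => cos (t * x + b)).
  by move=> x; apply: continuous_comp; [exact: cl|exact: continuous_cos].
have cs : continuous (fun x : R => sin (t * x + b)).
  by move=> x; apply: continuous_comp; [exact: cl|exact: continuous_sin].
move=> x; apply: cvgB; apply: cvgM; try exact: cvg_cst.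
  by apply: cvgM; [exact: cc|exact: cg].
by apply: cvgM; [apply: cvgM; [exact: cvg_id|exact: cs]|exact: cg].
Qed.

Let cvgG t : (G t n%:R - G t (- n%:R)) @[n --> \oo] --> (0 : R).
Proof.
set c := expR (- (s ^+ 2 *+ 2)^-1).
have c1 : `|c| < 1.
  rewrite ger0_norm ?expR_ge0// expR_lt1 oppr_lt0 invr_gt0.
  by rewrite pmulrn_lgt0.
(* At |x| = n the exponent is proportional to n^2 >= n, so the boundary terms are below a geometric
   sequence. *)
have gle (x : R) n : `|x| = n%:R -> g x <= normal_peak s * c ^+ n.
  move=> xn; rewrite gE ler_pM2l ?normal_peak_gt0// -expRM_natl ler_expR.
  rewrite -real_normK ?num_real// xn mulrN mulNr lerN2.
  rewrite ler_pM2r ?invr_gt0 ?pmulrn_lgt0//.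
  by rewrite -natrX ler_nat -mulnn; case: (n) => // k; rewrite leq_pmulr.
apply/norm_cvg0P.
have h0 : (2 * normal_peak s) * c ^+ n @[n --> \oo] --> (0 : R).
  by rewrite -(mulr0 (2 * normal_peak s)); apply: cvgMr; exact: cvg_expr.
apply: (squeeze_cvgr _ (cvg_cst 0) h0); apply/nearW => n.
rewrite normr_ge0/= (le_trans (ler_normB _ _))// -mulrA mulr2n mulrDl mul1r lerD//.
  rewrite normrM (ger0_norm (g_ge0 _)) (le_trans _ (gle n%:R n _)) ?normr_nat//.
  by rewrite ler_piMl// sin_max.
rewrite normrM (ger0_norm (g_ge0 _)) (le_trans _ (gle (- n%:R) n _)) ?normrN ?normr_nat//.
by rewrite ler_piMl// sin_max.
Qed.

Let ftcG t n : (0 < n)%N ->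
  (\int[mu]_(x in `[(- n%:R)%R, n%:R]) (G' t x)%:E = (G t n%:R)%:E - (G t (- n%:R))%:E)%E.
Proof.
move=> n0; have nn : - n%:R < n%:R :> R by rewrite gtrN// ltr0n.
have cG : continuous (G t).
  by move=> x; apply/differentiable_continuous/derivable1_diffP;
    exact: (@ex_derive _ _ _ _ _ _ _ (derG t x)).
apply: continuous_FTC2 => //.
- by apply: continuous_subspaceT; exact: contG'.
- split.
  + by move=> x _; exact: (@ex_derive _ _ _ _ _ _ _ (derG t x)).
  + exact/cvg_at_right_filter/cG.
  + exact/cvg_at_left_filter/cG.
- by move=> x _; rewrite derive1E; exact: (@derive_val _ _ _ _ _ _ _ (derG t x)).
Qed.

(** The fundamental theorem on [-n, n] leaves only boundary terms, which vanish by [cvgG]; dominated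
    convergence passes to the whole line. *)
Let intG'0 t : \int[mu]_x G' t x = 0.
Proof.
pose f_ n := (EFin \o G' t) \_ `[(- n%:R)%R, n%:R].
have mG' : measurable_fun setT (EFin \o G' t) by exact: (measurable_int mu).
have mf_ n : measurable_fun setT (f_ n).
  apply/(measurable_restrictT _ _).1 => //; exact: measurable_funTS.
have [|||_ _ h] := @dominated_convergence _ _ R mu _ measurableT f_ (EFin \o G' t)
  (fun x => `|(G' t x)%:E|%E) mf_ mG'.
- apply/aeW => x _; apply: cvg_near_cst; near=> n.
    rewrite /f_ patchE mem_set//= in_itv/= -ler_norml.
    by near: n; exact: nbhs_infty_ger.
- exact/integrable_abse/int_G'.
- apply/aeW => x n _; rewrite /f_ patchE; case: ifPn => // _.
    by rewrite abse0.
suff : (\int[mu]_x f_ n x)%E @[n --> \oo] --> 0%E.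
  by move=> h0; rewrite /Rintegral (cvg_unique _ h h0).
have cG : ((G t n%:R - G t (- n%:R))%:E @[n --> \oo] --> 0%:E)%E.
  by apply: cvg_EFin; [exact: nearW|exact: cvgG].
apply: cvg_trans cG.
apply: near_eq_cvg; near=> n.
rewrite /f_ -integral_mkcond ftcG//.
by near: n; exact: nbhs_infty_gt.
Unshelve. all: by end_near. Qed.

Let odePhi t : is_derive t (1 : R) Phi (- (t * s ^+ 2) * Phi t).
Proof.
have := derPhi t; congr is_derive.
have := intG'0 t; rewrite RintegralB//; last 2 first.
- rewrite /comp; under eq_fun do rewrite EFinM.
  by apply: integrableZl => //; exact: int_F.
- rewrite /comp; under eq_fun do rewrite EFinM.
  by apply: integrableZl => //; exact: int_xsin.
rewrite (RintegralZl t measurableT (int_F t)).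
rewrite (RintegralZl (s ^- 2) measurableT (int_xsin t)).
rewrite -/(Phi t) => /eqP; rewrite subr_eq0 => /eqP e.
have -> : Rintegral mu setT (fun x => x * sin (t * x + b) * g x) =
  s ^+ 2 * (t * Phi t) by rewrite e mulVKf ?gt_eqF.
by ring.
Qed.

Lemma Rint_normal_cos :
  \int[normal_prob 0 s]_x cos (x + b) = expR (- (s ^+ 2 / 2)) * cos b.
Proof.
have -> : \int[normal_prob 0 s]_x cos (x + b) = Phi 1.
  rewrite /Rintegral (@integral_density _ _ _ mu _ g)//.
    by rewrite /Phi /Rintegral /F; under [in RHS]eq_integral do rewrite mul1r.
  by apply: bmf_cos; under eq_fun do rewrite -[X in X + b]mul1r; exact: mlin.
have Phi0 : Phi 0 = cos b.
  rewrite /Phi /F; under eq_Rintegral do rewrite mul0r add0r.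
  rewrite RintegralZl//; last exact: integrable_normal_pdf.
  by rewrite /Rintegral integral_normal_pdf mulr1.
(* By [odePhi] this product has zero derivative in t, so its values at 1 and at 0 agree. *)
have : Phi 1 * expR (s ^+ 2 / 2 * 1 ^+ 2) = Phi 0 * expR (s ^+ 2 / 2 * 0 ^+ 2).
  apply: (@is_derive_0_is_cst _ (fun t => Phi t * expR (s ^+ 2 / 2 * t ^+ 2))) => t.
  have := odePhi t => dP.
  have -> : (fun t => Phi t * expR (s ^+ 2 / 2 * t ^+ 2)) =
    (fun t => Phi t *: expR ((s ^+ 2 / 2) *: t ^+ 2)) by [].
  apply: is_derive_eq; rewrite /GRing.scale/=.
  by field.
rewrite Phi0 expr0n/= mulr0 expR0 mulr1 expr1n mulr1 => <-.
by rewrite mulrC -mulrA -expRD subrr expR0 mulr1.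
Qed.

End gaussian_characteristic_function.

(** * Independence *)

Section restricted_image_measure.
Context d d' (T1 : measurableType d) (T2 : measurableType d') (R : realType).
Variables (m : {measure set T1 -> \bar R}) (D : set T1) (f : T1 -> T2).
Hypotheses (mD : measurable D) (Dfin : (m D < +oo)%E)
  (mf : measurable_fun setT f).

(** Only [m D] has to be finite, so Lebesgue measure restricted to a ball qualifies. The hypotheses
    are arguments so that the measure instances can be attached. It is used for joint laws on an
    event and for the cone measure. *)
Definition rimage of measurable D & (m D < +oo)%E & measurable_fun setT f :=
  fun A => m (f @^-1` A `&` D).

Local Notation mu := (rimage mD Dfin mf).

Let mpre A : measurable A -> measurable (f @^-1` A `&` D).
Proof.
by move=> mA; apply: measurableI => //; rewrite -[X in measurable X]setTI; exact: mf.
Qed.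

Let rimage0 : mu set0 = 0%E.
Proof. by rewrite /rimage preimage_set0 set0I measure0. Qed.

Let rimage_ge0 A : (0 <= mu A)%E.
Proof. exact: measure_ge0. Qed.

Let rimage_sigma_additive : semi_sigma_additive mu.
Proof.
move=> F mF tF mUF; rewrite /rimage preimage_bigcup setI_bigcupl.
apply: measure_semi_sigma_additive.
- by move=> n; exact: mpre.
- apply/trivIsetP => /= i j _ _ ij; rewrite setIACA -preimage_setI.
  by move/trivIsetP : tF => /(_ _ _ _ _ ij) ->//; rewrite preimage_set0 set0I.
- by rewrite -setI_bigcupl -preimage_bigcup; exact: mpre.
Qed.

HB.instance Definition _ := isMeasure.Build _ _ _ mu
  rimage0 rimage_ge0 rimage_sigma_additive.

Let rimage_fin : fin_num_fun mu.
Proof.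
move=> A mA; rewrite ge0_fin_numE//.
apply: le_lt_trans Dfin; apply: le_measure; rewrite ?inE//.
exact: mpre.
Qed.

HB.instance Definition _ := Measure_isFinite.Build _ _ _ mu rimage_fin.

End restricted_image_measure.

Lemma Rint_prodM d1 d2 (T1 : measurableType d1) (T2 : measurableType d2)
  (R : realType) (m1 : probability T1 R) (m2 : probability T2 R)
  (f : T1 -> R) (g : T2 -> R) : bmf f -> bmf g ->
  \int[(m1 \x m2)%E]_z (f z.1 * g z.2) = (\int[m1]_x f x) * (\int[m2]_y g y).
Proof.
move=> bf bg.
pose m12 : probability _ R := (m1 \x m2)%E.
have b12 : bmf (fun z : T1 * T2 => f z.1 * g z.2).
  by apply: bmfM; [apply: (bmf_comp bf)|apply: (bmf_comp bg)].
have int12 := bmf_integrable m12 b12.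
rewrite /Rintegral -integral12_prod_meas1//.
transitivity (\int[m1]_x ((\int[m2]_y g y) * f x)).
  congr fine; apply: eq_integral => x _; rewrite /fubini_F/= mulrC.
  by rewrite (@bmf_Rint _ _ _ m2 (fun y => f x * g y)) ?RintZ//;
    apply: bmfM => //; exact: bmf_cst.
by rewrite RintZ// mulrC.
Qed.

Section independence.
Context d {T : measurableType d} {R : realType}.
Variable P : probability T R.
Implicit Types (U V : T -> R).

Definition indep_rv U V := forall A B : set R, measurable A -> measurable B ->
  P (U @^-1` A `&` V @^-1` B) = (P (U @^-1` A) * P (V @^-1` B))%E.

Lemma indep_rv_comp U V (g h : R -> R) : measurable_fun setT g ->
  measurable_fun setT h -> indep_rv U V -> indep_rv (g \o U) (h \o V).
Proof.
move=> mg mh UV A B mA mB.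
apply: (UV (g @^-1` A) (h @^-1` B)).
  by rewrite -[X in measurable X]setTI; exact: mg.
by rewrite -[X in measurable X]setTI; exact: mh.
Qed.

(** By independence the joint law and the product of the marginal laws agree on rectangles, hence
    everywhere; Fubini then factors the integral. *)
Lemma indep_expectM U V : bmf U -> bmf V -> indep_rv U V ->
  \int[P]_w (U w * V w) = (\int[P]_w U w) * (\int[P]_w V w).
Proof.
move=> bU bV UV.
have [mU [M UM]] := bU; have [mV [N VN]] := bV.
(* The product of coordinates is unbounded on the plane. Clamping at the bounds of [U] and [V] makes
   it bounded and changes nothing on their values. *)
pose c (K x : R) := Num.max (- K) (Num.min K x).
have cE K (W : T -> R) : (forall w, `|W w| <= K) -> forall w, c K (W w) = W w.
  move=> WK w; have := WK w; rewrite ler_norml => /andP[h1 h2].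
  by rewrite /c (min_idPr h2) (max_idPr h1).
have bc K : bmf (c K).
  split.
    apply: measurable_maxr; first exact: measurable_cst.
    by apply: measurable_minr => //; exact: measurable_cst.
  exists `|K| => x; rewrite /c ler_norml le_max ge_max lerN2 ler_norm/=.
  rewrite ge_min ler_norm/= andbT -normrN ler_norm.
  by [].
pose U' : {mfun T >-> R} := mfun_Sub (mem_set mU).
pose V' : {mfun T >-> R} := mfun_Sub (mem_set mV).
pose m1 : probability _ R := distribution P U'.
pose m2 : probability _ R := distribution P V'.
have mUV : measurable_fun setT (fun w => (U w, V w)).
  exact: measurable_fun_pair.
pose UV' : {mfun T >-> _} := mfun_Sub (mem_set mUV).
pose m12 : probability _ R := distribution P UV'.
pose f (z : R * R) := c M z.1 * c N z.2.
have bf : bmf f by apply: bmfM; apply: (bmf_comp (bc _)).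
have e1 : \int[P]_w (U w * V w) = \int[m12]_z f z.
  rewrite /Rintegral /m12 integral_distribution//.
  - by congr fine; apply: eq_integral => w _ /=; rewrite /f/= !cE.
  - by apply/measurable_EFinP; case: bf.
  - by apply: (@bmf_integrable _ _ _ P (f \o _)); exact: (bmf_comp bf mUV).
have e2 (W : T -> R) K (bW : bmf W) (W' : {mfun T >-> R}) : (W' : T -> R) = W ->
    (forall w, `|W w| <= K) ->
    \int[P]_w W w = \int[distribution P W']_x c K x.
  move=> eW WK; rewrite /Rintegral integral_distribution//.
  - by congr fine; apply: eq_integral => w _ /=; rewrite eW cE.
  - by apply/measurable_EFinP; case: (bc K).
  - by apply: (@bmf_integrable _ _ _ P (c K \o _)); apply: bmf_comp.
rewrite (e2 U M bU U')// (e2 V N bV V')// -/m1 -/m2 e1.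
have -> : \int[m12]_z f z = \int[(m1 \x m2)%E]_z f z.
  rewrite /Rintegral; congr fine; apply: eq_measure_integral => A mA _.
  by apply/esym; apply: product_measure_unique.
exact: Rint_prodM.
Qed.

(** Both sides are finite measures in [C]: the image of [P] restricted to [D], and the image of [P]
    scaled by [P D]. They agree on rectangles, which generate the product sigma-algebra and are
    stable under intersection. *)
Lemma indep_joint_event U V D : measurable_fun setT U -> measurable_fun setT V ->
  measurable D ->
  (forall A B, measurable A -> measurable B ->
    P (U @^-1` A `&` V @^-1` B `&` D) = (P (U @^-1` A `&` V @^-1` B) * P D)%E) ->
  forall C : set (R * R), measurable C ->
    P ((fun w => (U w, V w)) @^-1` C `&` D) =
    (P ((fun w => (U w, V w)) @^-1` C) * P D)%E.
Proof.
move=> mU mV mD rect.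
have mUV : measurable_fun setT (fun w => (U w, V w)).
  exact: measurable_fun_pair.
have fin E : measurable E -> (P E < +oo)%E.
  by move=> mE; rewrite ltey_eq fin_num_measure.
pose m1 : {measure set _ -> \bar R} := rimage mD (fin _ mD) mUV.
have k0 : 0 <= fine (P D) by rewrite fine_ge0.
pose m2 : {measure set _ -> \bar R} :=
  mscale (NngNum k0) (rimage measurableT (fin _ measurableT) mUV).
pose G : set (set (R * R)) :=
  [set A `*` B | A in measurable & B in measurable].
have m2E C : m2 C = (P ((fun w => (U w, V w)) @^-1` C) * P D)%E.
  rewrite /m2/= /mscale/= /rimage setIT muleC fineK//.
  exact: fin_num_measure.
move=> C mC; rewrite -m2E -[LHS]/(m1 C).
apply: (measure_unique G (fun=> setT)) => //.
- exact: measurable_prod_measurableType.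
- move=> _ _ [A1 mA1 [B1 mB1 <-]] [A2 mA2 [B2 mB2 <-]].
  rewrite -setXI; exists (A1 `&` A2); first exact: measurableI.
  by exists (B1 `&` B2) => //; exact: measurableI.
- by move=> _; exists setT => //; exists setT => //; rewrite setXTT.
- by rewrite bigcup_const.
- by move=> _ [A mA [B mB <-]]; rewrite m2E -rect.
- by move=> _; apply: (fin (_ `&` D)); rewrite preimage_setT setTI.
Qed.

Variable Y : nat -> T -> R.
Hypothesis mY : forall i, measurable_fun setT (Y i).
Hypothesis iY : mutually_independent P Y.

Definition psum n w := \sum_(i < n) Y i w.

Lemma measurable_psum n : measurable_fun setT (psum n).
Proof. by apply: measurable_sum => i; exact: mY. Qed.

Let mYB i A : measurable A -> measurable (Y i @^-1` A).
Proof. by move=> mA; rewrite -[X in measurable X]setTI; exact: mY. Qed.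

(* The events of the remaining variables are carried along so that the
   induction can absorb them one at a time. *)
Lemma psum_indep_event n (s : seq nat) (B : nat -> set R) (A : set R) :
  uniq s -> all (leq n) s -> (forall i, measurable (B i)) -> measurable A ->
  P (psum n @^-1` A `&` \big[setI/setT]_(i <- s) (Y i @^-1` B i)) =
  (P (psum n @^-1` A) * P (\big[setI/setT]_(i <- s) (Y i @^-1` B i)))%E.
Proof.
elim: n s A B => [|n ih] s A B us /allP ns mB mA.
  have [A0|A0] := pselect (A 0).
    have -> : psum 0 @^-1` A = setT.
      by apply/seteqP; split => // w _; rewrite /= /psum big_ord0.
    by rewrite setTI probability_setT mul1e.
  have -> : psum 0 @^-1` A = set0.
    by apply/seteqP; split => // w; rewrite /= /psum big_ord0.
  by rewrite set0I measure0 mul0e.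
set D := \big[setI/setT]_(i <- s) _.
have mD : measurable D by apply: bigsetI_measurable => i _; exact: mYB.
pose C := (fun z : R * R => z.1 + z.2) @^-1` A.
have mC : measurable C.
  rewrite -[X in measurable X]setTI.
  have : measurable_fun setT (fun z : R * R => z.1 + z.2).
    by apply: measurable_funD; [exact: measurable_fst|exact: measurable_snd].
  exact.
have -> : psum n.+1 @^-1` A = (fun w => (psum n w, Y n w)) @^-1` C.
  by apply/seteqP; split => w; rewrite /C /= /psum big_ord_recr.
apply: indep_joint_event => //; first exact: measurable_psum.
move=> A' B' mA' mB'.
have sn : n \notin s by apply/negP => /ns; rewrite ltnn.
(* As [n] is not in [s], the set attached to index [n] is free and can be overwritten by [B']. The
   induction hypothesis is then used for [n :: s] and for [[:: n]]. *)
pose B2 i := if i == n then B' else B i.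
have mB2 i : measurable (B2 i) by rewrite /B2; case: ifP.
have DE : \big[setI/setT]_(i <- s) (Y i @^-1` B2 i) = D.
  apply: eq_big_seq => i si; rewrite /B2; case: eqP => // e.
  by rewrite -e si in sn.
have us' : uniq (n :: s) by rewrite /= sn.
have ns' : all (leq n) (n :: s).
  by rewrite /= leqnn/=; apply/allP => i /ns /ltnW.
have := ih (n :: s) A' B2 us' ns' mB2 mA'.
rewrite (iY us' mB2) !big_cons DE {1 2}/B2 eqxx setIA => ->.
have := ih [:: n] A' B2 isT _ mB2 mA'.
rewrite /= leqnn big_seq1 {1 2}/B2 eqxx => -> //.
by rewrite -(iY _ mB2)// DE muleA.
Qed.

Lemma psum_indep n : indep_rv (psum n) (Y n).
Proof.
move=> A B mA mB; have := @psum_indep_event n [:: n] (fun=> B) A isT.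
by rewrite /= leqnn !big_seq1; exact.
Qed.

Lemma psum_expectM n (g h : R -> R) : measurable_fun setT g ->
  measurable_fun setT h -> bmf (g \o psum n) -> bmf (h \o Y n) ->
  \int[P]_w (g (psum n w) * h (Y n w)) =
  (\int[P]_w g (psum n w)) * (\int[P]_w h (Y n w)).
Proof.
move=> mg mh bg bh; apply: (@indep_expectM (g \o psum n) (h \o Y n)) => //.
by apply: indep_rv_comp => //; exact: psum_indep.
Qed.

End independence.

Lemma mutually_independent_comp d1 d2 d3 (T1 : measurableType d1)
  (T2 : measurableType d2) (T3 : measurableType d3) (R : realType)
  (P : probability T1 R) (X : nat -> T1 -> T2) (f : T2 -> T3) :
  measurable_fun setT f -> mutually_independent P X ->
  mutually_independent P (fun i => f \o X i).
Proof.
move=> mf iX s A us mA.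
have := iX s (fun i => f @^-1` A i) us; apply => i.
by rewrite -[X in measurable X]setTI; exact: mf.
Qed.

(** * Sums of bounded independent variables *)

Section taylor_bounds.
Context {R : realType}.

(** The mean value theorem gives [f x = df c * x] with [|c| <= |x|]. Starting from |cos| <= 1, each
    of the following bounds on sine and cosine feeds the next; the factorials are given up. *)
Lemma mvt_power_bound (f df : R -> R) k :
  (forall x, is_derive x (1 : R) f (df x)) -> f 0 = 0 ->
  (forall x, `|df x| <= `|x| ^+ k) -> forall x, `|f x| <= `|x| ^+ k.+1.
Proof.
move=> fdf f0 dfk x.
have cf a b : {within `[a, b], continuous f}.
  apply: derivable_within_continuous => y _.
  exact: (@ex_derive _ _ _ _ _ _ _ (fdf y)).
have [c cx fx] : exists2 c, `|c| <= `|x| & f x = df c * x.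
  have [x0|x0] := leP 0 x.
    have [c] := @MVT_segment _ f df 0 x x0 (fun y _ => fdf y) (cf _ _).
    rewrite in_itv/= => /andP[c0 cx]; rewrite f0 !subr0 => ->.
    by exists c => //; rewrite !ger0_norm.
  have [c] := @MVT_segment _ f df x 0 (ltW x0) (fun y _ => fdf y) (cf _ _).
  rewrite in_itv/= => /andP[cx c0]; rewrite f0 !sub0r mulrN => /oppr_inj ->.
  by exists c => //; rewrite !ler0_norm ?lerN2// ltW.
rewrite fx normrM exprSr ler_wpM2r// (le_trans (dfk c))//.
by rewrite lerXn2r ?nnegrE.
Qed.

Lemma norm_sin_le (x : R) : `|sin x| <= `|x|.
Proof.
rewrite -[leRHS]expr1.
apply: (@mvt_power_bound _ (fun x => cos x)); first exact: sin0.
by move=> y; rewrite expr0 cos_max.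
Qed.

Lemma norm_cosB1_le (x : R) : `|cos x - 1| <= `|x| ^+ 2.
Proof.
apply: (@mvt_power_bound (fun x => cos x - 1) (fun x => - sin x)).
- by move=> y; apply: is_derive_eq; rewrite oppr0 addr0.
- by rewrite cos0 subrr.
- by move=> y; rewrite normrN expr1 norm_sin_le.
Qed.

Lemma norm_sinBid_le (x : R) : `|sin x - x| <= `|x| ^+ 3.
Proof.
apply: (@mvt_power_bound (fun x => sin x - x) (fun x => cos x - 1)).
- by rewrite sin0 subrr.
- exact: norm_cosB1_le.
Qed.

Lemma norm_cosB_le (x : R) : `|cos x - (1 - x ^+ 2 / 2)| <= `|x| ^+ 4.
Proof.
apply: (@mvt_power_bound (fun x => cos x - (1 - x ^+ 2 / 2)) (fun x => - (sin x - x))).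
- by move=> y; apply: is_derive_eq; rewrite /GRing.scale/=; field.
- by rewrite cos0 expr0n/= mul0r subr0 subrr.
- by move=> y; rewrite normrN norm_sinBid_le.
Qed.

(** Squeeze: 1 - x <= exp(-x) <= 1/(1+x) <= 1 - x + x^2. *)
Lemma norm_expRB_le (x : R) : 0 <= x -> `|expR (- x) - (1 - x)| <= x ^+ 2.
Proof.
move=> x0; have h1 := expR_ge1Dx (- x).
rewrite ger0_norm ?subr_ge0//.
have h2 := expR_ge1Dx x.
have h3 : expR (- x) <= (1 + x)^-1.
  by rewrite expRN lef_pV2// ?posrE ?expR_gt0// ltr_wpDr.
have h4 : (1 + x)^-1 <= 1 - x + x ^+ 2.
  have p : 0 < 1 + x by rewrite ltr_wpDr.
  rewrite -div1r ler_pdivrMr//.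
  by have : 0 <= x ^+ 3; [rewrite exprn_ge0|lra].
by lra.
Qed.

Lemma cos_lipschitz (x y : R) : `|cos x - cos y| <= `|x - y|.
Proof.
wlog xy : x y / y <= x.
  move=> h; have [|/ltW] := leP y x; first exact: h.
  by rewrite (distrC (cos x)) (distrC x); exact: h.
have cf : {within `[y, x], continuous (@cos R)}.
  by apply: continuous_subspaceT; exact: continuous_cos.
have [c _ ->] := @MVT_segment _ (@cos R) (fun x => - sin x) y x xy
  (fun z _ => is_derive_cos z) cf.
by rewrite normrM normrN ler_piMl// sin_max.
Qed.

End taylor_bounds.

Lemma cvg_inv_sqrt (R : realType) (K : R) :
  K * (Num.sqrt n%:R)^-1 @[n --> \oo] --> (0 : R).
Proof.
have h : K * (Num.sqrt n.+1%:R)^-1 @[n --> \oo] --> (0 : R).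
  rewrite -(mulr0 K); apply: cvgMr.
  have : Num.sqrt (n.+1%:R^-1) @[n --> \oo] --> Num.sqrt (0 : R).
    apply: (@cvg_comp _ _ _ (fun n => n.+1%:R^-1) (@Num.sqrt R)).
      exact: cvg_harmonic.
    exact: sqrt_continuous.
  by rewrite sqrtr0; under eq_fun do rewrite sqrtrV//.
by rewrite -(cvg_shiftS _ _).
Qed.

(** * Moments, strong law and central limit theorem for bounded centred independent variables *)

Section bounded_centered_sums.
Context d {T : measurableType d} {R : realType}.
Variables (P : probability T R) (Y : nat -> T -> R) (B v : R).
Hypothesis mY : forall i, measurable_fun setT (Y i).
Hypothesis iY : mutually_independent P Y.
Hypothesis YB : forall i w, `|Y i w| <= B.
Hypothesis EY : forall i, \int[P]_w Y i w = 0.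
Local Notation S := (psum Y).

Let bY i : bmf (Y i). Proof. by split => //; exists B => w. Qed.

Let bS n : bmf (S n). Proof. exact: bmf_sum. Qed.

Let B0 : 0 <= B.
Proof. by have := YB 0 point; apply: le_trans. Qed.

Let mX k : measurable_fun setT (fun x : R => x ^+ k).
Proof. exact: measurable_funX. Qed.

Let EYk i k : `|\int[P]_w (Y i w ^+ k)| <= B ^+ k.
Proof.
by apply: Rint_prob_le => [|w]; [exact: bmfX|rewrite normrX lerXn2r ?nnegrE].
Qed.

Let EM n i j : \int[P]_w (S n w ^+ i * Y n w ^+ j) =
  (\int[P]_w (S n w ^+ i)) * (\int[P]_w (Y n w ^+ j)).
Proof.
by apply: (@psum_expectM _ _ _ P Y mY iY n (fun x => x ^+ i) (fun x => x ^+ j)) => //;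
  exact: bmfX.
Qed.

Lemma Rint_psum n : \int[P]_w S n w = 0.
Proof.
rewrite /psum Rint_sum//; apply: big1 => i _; exact: EY.
Qed.

Lemma Rint_psum2_le n : \int[P]_w (S n w ^+ 2) <= n%:R * B ^+ 2.
Proof.
elim: n => [|n ih].
  under eq_Rintegral do rewrite /psum big_ord0 expr0n.
  by rewrite Rint_prob_cst mul0r.
have -> : \int[P]_w (S n.+1 w ^+ 2) =
    \int[P]_w (S n w ^+ 2 + (2 * (S n w ^+ 1 * Y n w ^+ 1) + Y n w ^+ 2)).
  by apply: eq_Rintegral => w _; rewrite /psum big_ord_recr/=; ring.
have b1 : bmf (fun w => S n w ^+ 1 * Y n w ^+ 1) by apply: bmfM; exact: bmfX.
have b2 : bmf (fun w => 2 * (S n w ^+ 1 * Y n w ^+ 1)).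
  by apply: bmfM => //; exact: bmf_cst.
rewrite RintD//; last 2 first.
  exact: bmfX.
  by apply: bmfD => //; exact: bmfX.
rewrite RintD//; last exact: bmfX.
rewrite RintZ// EM.
under [X in _ + (2 * (_ * X) + _)]eq_Rintegral do rewrite expr1.
rewrite EY mulr0 mulr0 add0r -natr1 mulrDl mul1r lerD//.
by rewrite (le_trans (ler_norm _) (EYk _ _)).
Qed.

(** Terms of the binomial expansion with a factor of mean zero drop out. One step adds at most 6 n
    B^4 + B^4, whereas the bound grows by 7 B^4 (2n + 1). *)
Lemma Rint_psum4_le n : \int[P]_w (S n w ^+ 4) <= 7 * B ^+ 4 * n%:R ^+ 2.
Proof.
elim: n => [|n ih].
  under eq_Rintegral do rewrite /psum big_ord0 expr0n.
  by rewrite Rint_prob_cst expr0n/= mulr0.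
have -> : \int[P]_w (S n.+1 w ^+ 4) =
    \int[P]_w (S n w ^+ 4 + (4 * (S n w ^+ 3 * Y n w ^+ 1) +
      (6 * (S n w ^+ 2 * Y n w ^+ 2) + (4 * (S n w ^+ 1 * Y n w ^+ 3) +
       Y n w ^+ 4)))).
  by apply: eq_Rintegral => w _; rewrite /psum big_ord_recr/=; ring.
have b1 i j : bmf (fun w => S n w ^+ i * Y n w ^+ j) by apply: bmfM; exact: bmfX.
have b2 c i j : bmf (fun w => c * (S n w ^+ i * Y n w ^+ j)).
  by apply: bmfM => //; exact: bmf_cst.
have b3 : bmf (fun w => 4 * (S n w ^+ 1 * Y n w ^+ 3) + Y n w ^+ 4).
  by apply: bmfD => //; exact: bmfX.
rewrite RintD//; last 2 first.
  exact: bmfX.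
  by apply: bmfD => //; apply: bmfD.
rewrite RintD//; last exact: bmfD.
rewrite RintD//.
rewrite RintD//; last exact: bmfX.
rewrite !RintZ// !EM.
have EY1 : \int[P]_w (Y n w ^+ 1) = 0.
  by under eq_Rintegral do rewrite expr1; exact: EY.
have ES1 : \int[P]_w (S n w ^+ 1) = 0.
  by under eq_Rintegral do rewrite expr1; exact: Rint_psum.
rewrite EY1 ES1 !mulr0 !mul0r mulr0 !add0r.
have h4 := le_trans (ler_norm _) (EYk n 4).
have h2 := le_trans (ler_norm _) (EYk n 2).
have s2 := Rint_psum2_le n.
have p2 : (\int[P]_w (S n w ^+ 2)) * (\int[P]_w (Y n w ^+ 2)) <= n%:R * B ^+ 4.
  have -> : n%:R * B ^+ 4 = (n%:R * B ^+ 2) * B ^+ 2 by ring.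
  by apply: ler_pM => //; apply: Rintegral_ge0 => w _; rewrite sqr_ge0.
have b4 : 0 <= B ^+ 4 by rewrite exprn_ge0.
have n4 : 0 <= n%:R * B ^+ 4 by rewrite mulr_ge0.
have -> : 7 * B ^+ 4 * n.+1%:R ^+ 2 =
  7 * B ^+ 4 * n%:R ^+ 2 + 14 * (n%:R * B ^+ 4) + 7 * B ^+ 4.
  by rewrite -natr1; ring.
by lra.
Qed.

Lemma sum_inv_square_le n : \sum_(0 <= i < n) (i.+1%:R ^- 2 : R) <= 2.
Proof.
case: n => [|n]; first by rewrite big_nil.
(* The induction needs the sharper telescoping bound. *)
suff : \sum_(0 <= i < n.+1) (i.+1%:R ^- 2 : R) <= 2 - n.+1%:R^-1.
  by move=> /le_trans; apply; rewrite gerBl.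
elim: n => [|n ih].
  by rewrite big_nat1 expr1n invr1; lra.
rewrite big_nat_recr//= (le_trans (lerD ih (lexx _)))//.
rewrite -[n.+2%:R]natr1; set x := n.+1%:R.
have x0 : 0 < x :> R by rewrite ltr0n.
have x1 : x + 1 != 0 by rewrite gt_eqF// ltr_wpDr.
rewrite -subr_ge0.
have -> : 2 - (x + 1)^-1 - (2 - x^-1 + (x + 1) ^- 2) = (x * (x + 1) ^+ 2)^-1.
  by clearbody x; field; rewrite x1 gt_eqF.
by rewrite invr_ge0 mulr_ge0// ?sqr_ge0// ltW.
Qed.

(* Fourth moments make the means summable, so no truncation is needed. *)
Lemma strong_law : {ae P, forall w, S n w / n%:R @[n --> \oo] --> (0 : R)}.
Proof.
pose f n w : R := (S n.+1 w / n.+1%:R) ^+ 4.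
have bf n : bmf (f n).
  by apply: bmfX; apply: bmfM => //; exact: bmf_cst.
have f0 n w : 0 <= f n w by rewrite exprn_even_ge0.
have If n : \int[P]_w f n w <= 7 * B ^+ 4 * n.+1%:R ^- 2.
  have -> : \int[P]_w f n w = n.+1%:R ^- 4 * \int[P]_w (S n.+1 w ^+ 4).
    rewrite -RintZ; last exact: bmfX.
    by apply: eq_Rintegral => w _; rewrite /f expr_div_n mulrC.
  rewrite ler_pdivrMl ?exprn_gt0// (le_trans (Rint_psum4_le _))//.
  rewrite le_eqVlt; apply/orP; left; apply/eqP; field.
  by rewrite ?natr1 ?nat1r pnatr_eq0.
(* The expected sum of the fourth powers is finite, so the sum is almost surely finite and its terms
   tend to 0. *)
have fin : (\int[P]_w (\sum_(n <oo) (f n w)%:E) < +oo)%E.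
  rewrite integral_nneseries//; last 2 first.
    by move=> n; apply/measurable_EFinP; case: (bf n).
    by move=> n w _; rewrite lee_fin.
  apply: (@le_lt_trans _ _ (7 * B ^+ 4 * 2)%:E); last exact: ltry.
  apply: lime_le.
    by apply: is_cvg_nneseries => n _ _; apply: integral_ge0 => w _; rewrite lee_fin.
  apply: nearW => n.
  under eq_bigr do rewrite bmf_Rint//.
  rewrite sumEFin lee_fin.
  apply: (@le_trans _ _ (\sum_(0 <= i < n) (7 * B ^+ 4 * i.+1%:R ^- 2))).
    by apply: ler_sum => i _; exact: If.
  rewrite -mulr_sumr ler_wpM2l ?sum_inv_square_le//.
  by rewrite mulr_ge0// exprn_ge0.
have mF : measurable_fun setT (fun w => (\sum_(n <oo) (f n w)%:E)%E).
  apply: ge0_emeasurable_sum => [n w _ _|n _]; first by rewrite lee_fin.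
  by apply/measurable_EFinP; case: (bf n).
have F0 w : (0 <= \sum_(n <oo) (f n w)%:E)%E.
  by apply: nneseries_ge0 => n _ _; rewrite lee_fin.
have : P.-integrable setT (fun w => (\sum_(n <oo) (f n w)%:E)%E).
  apply/integrableP; split => //.
  by under eq_integral do rewrite gee0_abs//.
move=> /(integrable_ae measurableT); apply: filterS => w /(_ I) finw.
have : f n w @[n --> \oo] --> (0 : R).
  apply: cvg_series_cvg_0.
  apply: (@nondecreasing_is_cvgn _ (series (f ^~ w))).
    move=> m n mn; rewrite /series/= (big_cat_nat _ mn)//= lerDl sumr_ge0//.
  exists (fine (\sum_(n <oo) (f n w)%:E)%E) => _ [n _ <-].
  rewrite -lee_fin fineK// /series/= -sumEFin.
  by apply: nneseries_lim_ge => i _ _; rewrite lee_fin.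
move=> /cvgrPdist_lt f0w.
rewrite -(cvg_shiftS _ _)/=.
apply/cvgrPdist_lt => e e0.
have := f0w (e ^+ 4) (exprn_gt0 4 e0).
apply: filterS => n; rewrite !sub0r !normrN /f normrX.
by rewrite ltr_pXn2r ?nnegrE// ltW.
Qed.

Hypothesis EY2 : forall i, \int[P]_w (Y i w ^+ 2) = v.

Let v0 : 0 <= v.
Proof. by rewrite -(EY2 0); apply: Rintegral_ge0 => w _; rewrite sqr_ge0. Qed.

(** The three summands bound the remainders of the cosine, of the exponential and of the sine,
    respectively. *)
Let K := B ^+ 4 + v ^+ 2 + B ^+ 3.

(** The addition formula and independence split off [Y n]. Its mean cosine agrees with 1 - v s^2/2,
    hence with the exponential, up to order s^4, and its mean sine is of order s^3 because [Y n] is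
    centred; [s <= 1] merges the orders. *)
Lemma cos_psum_step n (s b : R) : 0 <= s <= 1 ->
  `|\int[P]_w cos (s * S n.+1 w + b) -
    expR (- (v * s ^+ 2 / 2)) * \int[P]_w cos (s * S n w + b)| <= K * s ^+ 3.
Proof.
move=> /andP[s0 s1].
set q := expR _.
have mlS : measurable_fun setT (fun w => s * S n w + b).
  by apply: measurable_funD => //; apply: measurable_funM => //; case: (bS n).
have mlY : measurable_fun setT (fun w => s * Y n w).
  by apply: measurable_funM => //; case: (bY n).
have mlx : measurable_fun setT (fun x : R => s * x + b).
  by apply: measurable_funD => //; exact: measurable_funM.
have mly : measurable_fun setT (fun x : R => s * x) by exact: measurable_funM.
have bc := bmf_cos mlS. have bs := bmf_sin mlS.
have bcy := bmf_cos mlY. have bsy := bmf_sin mlY.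
have -> : \int[P]_w cos (s * S n.+1 w + b) =
  (\int[P]_w cos (s * S n w + b)) * (\int[P]_w cos (s * Y n w)) -
  (\int[P]_w sin (s * S n w + b)) * (\int[P]_w sin (s * Y n w)).
  rewrite -(@psum_expectM _ _ _ P Y mY iY n (fun x => cos (s * x + b))
    (fun x => cos (s * x)) (bmf_cos mlx).1 (bmf_cos mly).1 bc bcy).
  rewrite -(@psum_expectM _ _ _ P Y mY iY n (fun x => sin (s * x + b))
    (fun x => sin (s * x)) (bmf_sin mlx).1 (bmf_sin mly).1 bs bsy).
  rewrite -RintB; [|exact: bmfM|exact: bmfM].
  apply: eq_Rintegral => w _; rewrite /psum big_ord_recr/= -cosD.
  by congr cos; ring.
have B1 i k : `|s * Y n i| ^+ k <= B ^+ k * s ^+ k.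
  rewrite -exprMn lerXn2r ?nnegrE ?mulr_ge0//.
  by rewrite normrM (ger0_norm s0) mulrC ler_wpM2r.
have Ec : `|\int[P]_w cos (s * Y n w) - q| <= (B ^+ 4 + v ^+ 2) * s ^+ 3.
  have bq : bmf (fun w => 1 - (s * Y n w) ^+ 2 / 2).
    apply: bmfB; first exact: bmf_cst.
    apply: bmfM; last exact: bmf_cst.
    by apply: bmfX; apply: bmfM => //; exact: bmf_cst.
  have e1 : \int[P]_w (1 - (s * Y n w) ^+ 2 / 2) = 1 - v * s ^+ 2 / 2.
    have -> : \int[P]_w (1 - (s * Y n w) ^+ 2 / 2) =
      \int[P]_w (1 - (s ^+ 2 / 2) * (Y n w ^+ 2)).
      by apply: eq_Rintegral => w _; ring.
    rewrite RintB; [|exact: bmf_cst|]; last first.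
      by apply: bmfM; [exact: bmf_cst|exact: bmfX].
    by rewrite Rint_prob_cst RintZ ?EY2; [ring|exact: bmfX].
  have h1 : `|\int[P]_w cos (s * Y n w) - (1 - v * s ^+ 2 / 2)| <= B ^+ 4 * s ^+ 4.
    rewrite -e1 -RintB//; apply: Rint_prob_le; first exact: bmfB.
    by move=> w; rewrite (le_trans (norm_cosB_le _)).
  have h2 : `|q - (1 - v * s ^+ 2 / 2)| <= (v * s ^+ 2 / 2) ^+ 2.
    by apply: norm_expRB_le; rewrite !mulr_ge0 ?sqr_ge0.
  rewrite -(subrKA (1 - v * s ^+ 2 / 2)) (le_trans (ler_normD _ _))//.
  rewrite [X in _ + X]distrC mulrDl lerD//.
    apply: (le_trans h1); rewrite ler_wpM2l ?exprn_ge0//.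
    by rewrite exprS ler_piMl ?exprn_ge0.
  apply: (le_trans h2).
  have -> : (v * s ^+ 2 / 2) ^+ 2 = v ^+ 2 * (s * s ^+ 3 / 4) by field.
  rewrite ler_wpM2l ?sqr_ge0//.
  have s3 : 0 <= s ^+ 3 by rewrite exprn_ge0.
  rewrite ler_pdivrMr// mulrC ler_wpM2l//; lra.
have Es : `|\int[P]_w sin (s * Y n w)| <= B ^+ 3 * s ^+ 3.
  have bsY : bmf (fun w => s * Y n w) by apply: bmfM => //; exact: bmf_cst.
  have e1 : \int[P]_w (s * Y n w) = 0 by rewrite RintZ// EY mulr0.
  rewrite -[X in `|X|]subr0 -e1 -RintB//.
  apply: Rint_prob_le; first exact: bmfB.
  by move=> w; rewrite (le_trans (norm_sinBid_le _)).
set c := \int[P]_w cos (s * S n w + b) in bc *.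
set t := \int[P]_w sin (s * S n w + b) in bs *.
have c1 : `|c| <= 1 by apply: Rint_prob_le => // w; exact: cos_max.
have t1 : `|t| <= 1 by apply: Rint_prob_le => // w; exact: sin_max.
set x := \int[P]_w cos (s * Y n w) in Ec *.
set y := \int[P]_w sin (s * Y n w) in Es *.
have -> : c * x - t * y - q * c = c * (x - q) - t * y by ring.
rewrite (le_trans (ler_normB _ _))// /K mulrDl lerD// normrM.
  by rewrite (le_trans _ Ec)// ler_piMl.
by rewrite (le_trans _ Es)// ler_piMl.
Qed.

(** Each step multiplies the previous error by a factor of modulus at most 1, so the one-step errors
    merely add up. *)
Lemma cos_psum_dist n (s b : R) : 0 <= s <= 1 ->
  `|\int[P]_w cos (s * S n w + b) - expR (- (v * s ^+ 2 / 2)) ^+ n * cos b| <=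
  n%:R * (K * s ^+ 3).
Proof.
move=> s01; set q := expR _.
have q1 : `|q| <= 1.
  rewrite ger0_norm ?expR_ge0// expR_le1 oppr_le0.
  by apply: mulr_ge0 => //; apply: mulr_ge0 => //; exact: sqr_ge0.
elim: n => [|n ih].
  under eq_Rintegral do rewrite /psum big_ord0 mulr0 add0r.
  by rewrite Rint_prob_cst expr0 mul1r subrr normr0 mul0r.
rewrite -(subrKA (q * \int[P]_w cos (s * S n w + b))).
rewrite (le_trans (ler_normD _ _))// -natr1 mulrDl mul1r addrC lerD//; last first.
  exact: cos_psum_step.
rewrite exprS -mulrA -mulrBr normrM (le_trans _ ih)// ler_piMl//.
Qed.

Lemma cos_psum_cvg (b : R) :
  \int[P]_w cos ((Num.sqrt n%:R)^-1 * S n w + b) @[n --> \oo] -->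
  expR (- (v / 2)) * cos b.
Proof.
rewrite -(cvg_shiftS _ _)/=.
have K0 : 0 <= K by rewrite !addr_ge0 ?sqr_ge0 ?exprn_ge0.
have := cvg_inv_sqrt K; rewrite -(cvg_shiftS _ _)/= => h.
apply/subr_cvg0/norm_cvg0P.
apply: (squeeze_cvgr _ (cvg_cst 0) h); apply: nearW => n.
rewrite normr_ge0/=.
(* For this [s] the n-th power of the exponential is exactly exp(-v/2), and the accumulated error is
   K s. *)
set s := (Num.sqrt n.+1%:R)^-1.
have r0 : 0 < n.+1%:R :> R by rewrite ltr0n.
have s2 : s ^+ 2 = n.+1%:R^-1 by rewrite exprVn sqr_sqrtr// ltW.
have s01 : 0 <= s <= 1.
  rewrite invr_ge0 sqrtr_ge0/= invf_le1 ?sqrtr_gt0//.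
  by rewrite -[leLHS]sqrtr1 ler_sqrt ?ler1n.
have := cos_psum_dist n.+1 b s01.
rewrite -expRM_natl s2.
have -> : n.+1%:R * - (v / n.+1%:R / 2) = - (v / 2) by field; rewrite ?natr1 ?nat1r pnatr_eq0.
have -> : n.+1%:R * (K * s ^+ 3) = K * s.
  by rewrite exprS s2; field; rewrite ?natr1 ?nat1r pnatr_eq0.
by [].
Qed.

End bounded_centered_sums.

(** * Weak convergence from characteristic functions *)

Section trigonometric_polynomials.
Context {R : realType} {m : nat}.
Local Notation V := 'rV[R]_m.

(** The same expression as in [is_gaussian_vector], so its clauses apply to [lform] by
    conversion. *)
Definition lform (t x : V) : R := (x *m t^T) 0 0.

Lemma lformE t x : lform t x = \sum_j x 0 j * t 0 j.
Proof. by rewrite /lform mxE; apply: eq_bigr => j _; rewrite mxE. Qed.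

Lemma lformD t t' x : lform (t + t') x = lform t x + lform t' x.
Proof. by rewrite /lform linearD/= mulmxDr mxE. Qed.

Lemma lformB t t' x : lform (t - t') x = lform t x - lform t' x.
Proof. by rewrite /lform linearB/= mulmxBr !mxE. Qed.

Lemma lform_delta c j x : lform (c *: delta_mx 0 j) x = c * x 0 j.
Proof.
rewrite lformE (bigD1 j)//= big1 ?addr0 => [|i ij].
  by rewrite !mxE !eqxx mulr1 mulrC.
by rewrite !mxE eqxx (negbTE ij) !mulr0.
Qed.

Lemma continuous_lform t : continuous (lform t).
Proof.
move=> x.
have -> : lform t = fun x => \sum_j x 0 j * t 0 j.
  by apply/funext => y; rewrite lformE.
elim: (index_enum _) => [|j s ih].
  by under eq_fun do rewrite big_nil; exact: cst_continuous.
have -> : (fun x : V => \sum_(i <- j :: s) x 0 i * t 0 i) =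
    (fun x : V => x 0 j * t 0 j) \+ (fun x : V => \sum_(i <- s) x 0 i * t 0 i).
  by apply/funext => y; rewrite /= big_cons.
apply: continuousD => //; apply: continuousM; last exact: cst_continuous.
exact: coord_continuous.
Qed.

(* Allowing a phase makes sines cosines, so that products stay in one family. *)
Inductive trigpoly : (V -> R) -> Prop :=
| trig_cos c t b : trigpoly (fun x => c * cos (lform t x + b))
| trigD f g : trigpoly f -> trigpoly g -> trigpoly (fun x => f x + g x).

Lemma trig_cst c : trigpoly (fun=> c).
Proof.
have -> : (fun=> c) = (fun x : V => c * cos (lform 0 x + 0)).
  by apply/funext => x; rewrite /lform linear0 mulmx0 mxE addr0 cos0 mulr1.
exact: trig_cos.
Qed.

Lemma trigZ c f : trigpoly f -> trigpoly (fun x => c * f x).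
Proof.
elim=> [c' t b|g h _ tg _ th].
  by under eq_fun do rewrite mulrA; exact: trig_cos.
by under eq_fun do rewrite mulrDr; exact: trigD.
Qed.

Lemma trigM f g : trigpoly f -> trigpoly g -> trigpoly (fun x => f x * g x).
Proof.
elim=> [c t b|f1 f2 _ h1 _ h2] tg; last first.
  by under eq_fun do rewrite mulrDl; apply: trigD; [exact: h1|exact: h2].
elim: tg => [c' t' b'|g1 g2 _ h1 _ h2]; last first.
  by under eq_fun do rewrite mulrDr; exact: trigD.
have -> : (fun x => c * cos (lform t x + b) * (c' * cos (lform t' x + b'))) =
  (fun x => (c * c' / 2) * cos (lform (t + t') x + (b + b')) +
            (c * c' / 2) * cos (lform (t - t') x + (b - b'))).
  apply/funext => x; rewrite lformD lformB.
  have -> : lform t x + lform t' x + (b + b') = (lform t x + b) + (lform t' x + b').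
    by ring.
  have -> : lform t x - lform t' x + (b - b') = (lform t x + b) - (lform t' x + b').
    by ring.
  by rewrite (cosD (lform t x + b) (lform t' x + b')) cosB; field.
by apply: trigD; exact: trig_cos.
Qed.

Lemma trig_sum (I : Type) (s : seq I) (F : I -> V -> R) :
  (forall i, trigpoly (F i)) -> trigpoly (fun x => \sum_(i <- s) F i x).
Proof.
move=> tF; elim: s => [|i s ih].
  by under eq_fun do rewrite big_nil; exact: trig_cst.
by under eq_fun do rewrite big_cons; exact: trigD.
Qed.

Lemma trig_bounded f : trigpoly f -> exists2 M : R, 0 < M & forall x, `|f x| <= M.
Proof.
elim=> [c t b|g h _ [M M0 gM] _ [N N0 hN]].
  exists (`|c| + 1); first by rewrite ltr_wpDl.
  by move=> x; rewrite normrM ler_wpDr// ler_piMr// cos_max.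
by exists (M + N); [exact: addr_gt0|move=> x; rewrite (le_trans (ler_normD _ _))// lerD].
Qed.

Lemma continuous_trig f : trigpoly f -> continuous f.
Proof.
elim=> [c t b|g h _ cg _ ch] x; last exact: continuousD (cg x) (ch x).
apply: continuousM; first exact: cst_continuous.
apply: continuous_comp; last exact: continuous_cos.
by apply: continuousD; [exact: continuous_lform|exact: cst_continuous].
Qed.

(** Uniform on the whole space, not on a compact set: this keeps global bounds through absolute
    values and maxima. *)
Definition trig_approx (f : V -> R) := forall e, 0 < e ->
  exists2 p, trigpoly p & forall x, `|f x - p x| <= e.

Lemma trig_approxT f : trigpoly f -> trig_approx f.
Proof. by move=> tf e /ltW e0; exists f => // x; rewrite subrr normr0. Qed.

Lemma trig_approxD f g : trig_approx f -> trig_approx g ->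
  trig_approx (fun x => f x + g x).
Proof.
move=> af ag e e0; have e2 : 0 < e / 2 by rewrite divr_gt0.
have [p tp fp] := af _ e2; have [q tq gq] := ag _ e2.
exists (fun x => p x + q x); first exact: trigD.
move=> x; have -> : f x + g x - (p x + q x) = (f x - p x) + (g x - q x) by ring.
by rewrite (le_trans (ler_normD _ _))// (splitr e) lerD.
Qed.

Lemma trig_approxZ c f : trig_approx f -> trig_approx (fun x => c * f x).
Proof.
move=> af e e0; have c0 : 0 < `|c| + 1 by rewrite ltr_wpDl.
have [p tp fp] := af _ (divr_gt0 e0 c0).
exists (fun x => c * p x); first exact: trigZ.
move=> x; rewrite -mulrBr normrM.
rewrite (@le_trans _ _ ((`|c| + 1) * (e / (`|c| + 1))))//.
  by rewrite ler_pM// lerDl.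
by rewrite mulrC divfK// gt_eqF.
Qed.

Lemma bernoulli_bound (t : R) k : 0 <= t <= 1 -> (1 - t) ^+ k * (1 + k%:R * t) <= 1.
Proof.
move=> /andP[t0 t1]; elim: k => [|k ih].
  by rewrite expr0 mul0r addr0 mulr1.
apply: le_trans ih; rewrite exprSr -mulrA ler_wpM2l ?exprn_ge0 ?subr_ge0//.
rewrite -natr1; set n := k%:R.
have n0 : 0 <= n by rewrite /n.
by have := mulr_ge0 n0 (sqr_ge0 t); have := sqr_ge0 t; nra.
Qed.

(* Babylonian-type iteration r <- r + (y^2 - r^2)/2, increasing to |y|. *)
Fixpoint abs_iter (k : nat) (y : R) : R :=
  if k is k'.+1 then abs_iter k' y + 2^-1 * (y * y - abs_iter k' y * abs_iter k' y)
  else 0.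

Lemma abs_iter_bound k (y : R) : `|y| <= 1 ->
  0 <= abs_iter k y <= `|y| /\ `|y| - abs_iter k y <= `|y| * (1 - `|y| / 2) ^+ k.
Proof.
move=> y1; have yy : y * y = `|y| * `|y|.
  by rewrite -!expr2 real_normK// num_real.
elim: k => [|k [/andP[r0 ry] ih]] /=.
  by rewrite lexx normr_ge0 subr0 expr0 mulr1 lexx.
rewrite yy; set a := `|y| in r0 ry ih y1 *; set r := abs_iter k y in r0 ry ih *.
have a0 : 0 <= a by exact: le_trans ry.
have f0 : 0 <= 1 - (a + r) / 2 by lra.
(* The error is multiplied by 1 - (a + r)/2, which lies between 0 and 1 - a/2. *)
have e : a - (r + 2^-1 * (a * a - r * r)) = (a - r) * (1 - (a + r) / 2) by field.
have d0 : 0 <= a - r by rewrite subr_ge0.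
split; last first.
  rewrite e exprSr mulrA ler_pM// ; lra.
have := mulr_ge0 d0 f0; rewrite -e subr_ge0 => ->; rewrite andbT.
by rewrite addr_ge0// mulr_ge0// subr_ge0 ler_pM.
Qed.

(** The error |y| (1 - |y|/2)^k is bounded uniformly in y: with t = |y|/2, [bernoulli_bound] gives t
    (1 - t)^k <= 1/k, so small |y| does no harm. *)
Lemma abs_iter_le k (y : R) : `|y| <= 1 -> `| `|y| - abs_iter k.+1 y| <= 2 / k.+1%:R.
Proof.
move=> y1; have [/andP[r0 ry] h] := abs_iter_bound k.+1 y1.
rewrite ger0_norm ?subr_ge0//; apply: (le_trans h).
set t := `|y| / 2.
have t01 : 0 <= t <= 1 by rewrite /t divr_ge0//= ler_pdivrMr// mul1r (le_trans y1)// ler1n.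
have -> : `|y| = 2 * t by rewrite /t mulrC divfK.
have := bernoulli_bound k.+1 t01; move: t01 => /andP[t0 t1].
have p0 : 0 <= (1 - t) ^+ k.+1 by rewrite exprn_ge0// subr_ge0.
move=> b; rewrite -mulrA ler_wpM2l// -[leRHS]mul1r ler_pdivlMr ?ltr0n//.
apply: le_trans b; rewrite mulrDr mulr1 mulrC mulrA mulrAC -mulrA mulrC -mulrA.
by rewrite [X in X <= _](_ : _ = (1 - t) ^+ k.+1 * (k.+1%:R * t)) ?ler_wpDl//; ring.
Qed.

Lemma trig_abs_iter k c p : trigpoly p -> trigpoly (fun x => abs_iter k (c * p x)).
Proof.
move=> tp; elim: k => [|k ih] /=; first exact: trig_cst.
apply: trigD => //; apply: trigZ; apply: trigD.
  by apply: trigM; exact: trigZ.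
under eq_fun do rewrite -mulN1r.
by apply: trigZ; exact: trigM.
Qed.

Lemma trig_approx_norm f : trig_approx f -> trig_approx (fun x => `|f x|).
Proof.
move=> af e e0; have e2 : 0 < e / 2 by rewrite divr_gt0.
have [p tp fp] := af _ e2.
have [M M0 pM] := trig_bounded tp.
have [k /ltW kM] : exists k, 2 * M / (e / 2) < k%:R.
  exists (Num.bound (2 * M / (e / 2))); apply: archi_boundP.
  by rewrite divr_ge0 ?mulr_ge0// ltW.
(* [M] bounds [p] on the whole space, so the rescaled argument stays in [-1, 1], where the iteration
   converges. *)
exists (fun x => M * abs_iter k.+1 (M^-1 * p x)).
  exact/trigZ/trig_abs_iter.
move=> x; rewrite -(subrKA `|p x|) (le_trans (ler_normD _ _))// [leRHS]splitr lerD//.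
  by rewrite (le_trans (ler_dist_dist _ _)).
set y := M^-1 * p x.
have y1 : `|y| <= 1.
  by rewrite normrM normfV (gtr0_norm M0) ler_pdivrMl// mulr1.
have -> : `|p x| = M * `|y|.
  by rewrite normrM normfV (gtr0_norm M0) mulVKf// gt_eqF.
rewrite -mulrBr normrM (gtr0_norm M0).
apply: (@le_trans _ _ (M * (2 / k.+1%:R))).
  by rewrite ler_wpM2l ?abs_iter_le// ltW.
rewrite mulrA ler_pdivrMr ?ltr0n// mulrC -ler_pdivrMl// mulrC [M * 2]mulrC.
by rewrite [_ * (2 * M)]mulrC (le_trans kM)// ler_nat.
Qed.

Lemma trig_approx_max f g : trig_approx f -> trig_approx g ->
  trig_approx (fun x => Num.max (f x) (g x)).
Proof.
move=> af ag.
have -> : (fun x => Num.max (f x) (g x)) =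
  (fun x => 2^-1 * ((f x + g x) + `|f x + (-1) * g x|)).
  apply/funext => x; rewrite mulN1r; have [fg|fg] := leP (f x) (g x).
    by rewrite ler0_norm ?subr_le0//; field.
  by rewrite gtr0_norm ?subr_gt0//; field.
apply: trig_approxZ; apply: trig_approxD; first exact: trig_approxD.
by apply: trig_approx_norm; apply: trig_approxD => //; exact: trig_approxZ.
Qed.

Lemma trig_approx_bigmax (I : Type) (s : seq I) (c : R) (F : I -> V -> R) :
  (forall i, trig_approx (F i)) ->
  trig_approx (fun x => \big[Num.max/c]_(i <- s) F i x).
Proof.
move=> aF; elim: s => [|i s ih].
  by under eq_fun do rewrite big_nil; exact/trig_approxT/trig_cst.
by under eq_fun do rewrite big_cons; exact: trig_approx_max.
Qed.

Lemma oneBcos_ge (u : R) : `|u| <= 2^-1 -> u ^+ 2 / 4 <= 1 - cos u.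
Proof.
move=> u1; have := norm_cosB_le u; rewrite ler_norml => /andP[_ h].
have u2 : u ^+ 2 <= 4^-1.
  rewrite -real_normK ?num_real// (le_trans (lerXn2r 2 _ _ u1)) ?nnegrE//.
  by rewrite exprVn; lra.
have u4 : `|u| ^+ 4 <= u ^+ 2 / 4.
  have -> : `|u| ^+ 4 = u ^+ 2 * u ^+ 2.
    by rewrite -[u ^+ 2]real_normK ?num_real//; ring.
  by rewrite ler_wpM2l// sqr_ge0.
by lra.
Qed.

(** Each y in the cube yields a minorant of f there: f y minus a small constant minus a multiple of
    a trigonometric penalty [D y] that vanishes at y. The minorant is nearly f close to y, so by
    compactness a finite maximum is close to f on the cube. As penalties are nonnegative everywhere,
    it never exceeds M, even off the cube. *)
Lemma trig_cube_approx (f : V -> R) (M L e : R) : continuous f ->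
  (forall x, `|f x| <= M) -> 0 < L -> 0 < e ->
  exists2 p, trigpoly p & (forall x, `|p x| <= M + e) /\
    (forall x : V, (forall j, `|x 0 j| <= L) -> `|f x - p x| <= e).
Proof.
move=> cf fM L0 e0.
pose e4 := e / 4; have e40 : 0 < e4 by rewrite divr_gt0.
pose K : set V := [set x | forall j, `[(- L)%R, L]%classic (x 0 j)].
have KP x : K x <-> forall j, `|x 0 j| <= L.
  by split => h j; have := h j; rewrite /= in_itv/= ler_norml.
have Kc : compact K.
  have h := @rV_compact R m (fun=> `[(- L)%R, L]%classic) (fun=> @segment_compact R (- L) L).
  exact: h.
(* Coordinates in the cube differ by at most 2 L, so the cosines in [D] have arguments of modulus at
   most 1/2, the range of [oneBcos_ge]; periodicity is not felt there. *)
pose c := (4 * L)^-1; have c0 : 0 < c by rewrite invr_gt0 mulr_gt0.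
pose D (y x : V) := \sum_j (1 - cos (c * (x 0 j - y 0 j))).
have D_ge0 y x : 0 <= D y x.
  by apply: sumr_ge0 => j _; rewrite subr_ge0 cos_le1.
have Dyy y : D y y = 0.
  by apply: big1 => j _; rewrite subrr mulr0 cos0 subrr.
have tD y : trigpoly (D y).
  apply: trig_sum => j; apply: trigD; first exact: trig_cst.
  have -> : (fun x : V => - cos (c * (x 0 j - y 0 j))) =
    (fun x => (-1) * cos (lform (c *: delta_mx 0 j) x + (- c * y 0 j))).
    by apply/funext => x; rewrite lform_delta mulN1r mulrBr mulNr.
  exact: trig_cos.
have M0 : 0 <= M by rewrite (le_trans (normr_ge0 (f 0)))//.
have /choice[A HA] : forall y, exists Ay : R, 0 <= Ay /\
    (K y -> forall x, K x -> f y - e4 - Ay * D y x <= f x).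
  move=> y.
  have /cvgrPdist_lt /(_ _ e40) := cf y.
  move=> /nbhs_ballP[r /= r0 yr].
  (* Outside the ball some coordinate differs by at least r, hence [D y x >= kap], and the factor 2
     M / kap makes the penalty exceed the oscillation of f. *)
  pose kap := (c * r) ^+ 2 / 4.
  have kap0 : 0 < kap by rewrite divr_gt0// exprn_gt0// mulr_gt0.
  exists (2 * M / kap); split; first by rewrite divr_ge0// ?mulr_ge0// ltW.
  move=> Ky x Kx.
  have [yx|nyx] := pselect (ball y r x).
    have /= := yr _ yx; rewrite ltr_distl => /andP[h1 h2].
    have : 0 <= 2 * M / kap * D y x by rewrite mulr_ge0// divr_ge0 ?mulr_ge0// ltW.
    by lra.
  have [j hj] : exists j, r <= `|x 0 j - y 0 j|.
    apply: contrapT => /forallNP h; apply: nyx; split => // i j.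
    rewrite ord1 /ball/= distrC ltNge; exact/negP/h.
  have : kap <= D y x.
    rewrite /D (bigD1 j)//= ler_wpDr//.
      by apply: sumr_ge0 => i _; rewrite subr_ge0 cos_le1.
    apply: le_trans (oneBcos_ge _); last first.
      rewrite normrM (gtr0_norm c0) /c invfM -mulrA ler_pdivrMl//.
      rewrite ler_pdivrMl//.
      have := (KP x).1 Kx j; have := (KP y).1 Ky j.
      by have := ler_normB (x 0 j) (y 0 j); lra.
    rewrite ler_pM2r ?invr_gt0// -[leRHS]real_normK ?num_real//.
    rewrite lerXn2r ?nnegrE ?mulr_ge0// ?(ltW c0) ?(ltW r0)//.
    by rewrite normrM (gtr0_norm c0) ler_pM2l.
  move=> kD; have : 2 * M <= 2 * M / kap * D y x.
    by rewrite -mulrA ler_peMr ?mulr_ge0// mulrC ler_pdivlMr// mul1r.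
  have := fM x; have := fM y; rewrite !ler_norml => /andP[_ h1] /andP[h2 _].
  by lra.
pose H (y x : V) := f y - e4 + (- A y) * D y x.
have tH y : trigpoly (H y) by apply: trigD; [exact: trig_cst|exact: trigZ].
pose U (y : V) := [set x | f x - 2 * e4 < H y x]°.
have [s sK Ks] : exists2 s : seq V, (forall y, y \in s -> K y) &
    (forall x, K x -> exists2 y, y \in s & U y x).
  move: Kc; rewrite compact_cover => /(_ V K U)[|y Ky|s sK Ks].
  - by move=> y _; exact: open_interior.
  - exists y => //.
    suff : nbhs y [set x | f x - 2 * e4 < H y x] by [].
  have : H y x - f x @[x --> y] --> H y y - f y.
    exact: (continuousB (continuous_trig (tH y) (x:=y)) (cf y)).
  move=> /cvgrPdist_lt /(_ _ e40); apply: filterS => x /=.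
    rewrite {1}/H Dyy mulr0 addr0 ltr_distl => /andP[h1 h2].
    by lra.
  - exists (finmap.enum_fset s) => [y ys|x Kx]; first exact/set_mem/sK.
    by have [y ys] := Ks _ Kx; exists y.
(* Starting the maximum at -M keeps h above -M everywhere and below f on the cube, even if [s] is
   empty. *)
pose h x := \big[Num.max/(- M)]_(y <- s) H y x.
have ah : trig_approx h.
  by apply: trig_approx_bigmax => y; exact: trig_approxT.
have [p tp hp] := ah _ e40.
have hM x : `|h x| <= M.
  rewrite ler_norml; apply/andP; split; first by rewrite /h bigmax_ge_id.
  apply: bigmax_le; first by rewrite (le_trans _ M0)// oppr_le0.
  move=> y _; have := HA y => -[Ay _]; have := fM y; rewrite ler_norml => /andP[_].
  by have := mulr_ge0 Ay (D_ge0 y x); rewrite /H mulNr; lra.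
exists p => //; split => x.
  have -> : p x = h x - (h x - p x) by ring.
  rewrite (le_trans (ler_normB _ _))// lerD// (le_trans (hp x))//.
  by rewrite /e4; lra.
move=> /KP Kx.
have h1 : h x <= f x.
  rewrite /h big_seq; apply: bigmax_le; first by have := fM x; rewrite ler_norml => /andP[].
  move=> y ys; have [_ ] := HA y; move=> /(_ (sK y ys) x Kx).
  by rewrite /H mulNr.
have h2 : f x - 2 * e4 <= h x.
  have [y ys /interior_subset /= /ltW fH] := Ks x Kx.
  apply: (le_trans fH); rewrite /h; elim: (s) ys => // a l ih.
  by rewrite in_cons big_cons le_max => /predU1P[<-|/ih ->]; rewrite ?lexx ?orbT.
have := hp x; rewrite !ler_norml => /andP[h3 h4].
by rewrite /e4 in h1 h2 h3 h4; apply/andP; split; lra.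
Qed.

End trigonometric_polynomials.

Section weak_convergence.
Context {R : realType} {m : nat}.
Local Notation V := 'rV[R]_m.

(** Measurability of linear forms is what [is_gaussian_vector] provides for the limit vector. *)
Definition lmeasurable d (T : measurableType d) (U : T -> V) :=
  forall t, measurable_fun setT (fun w => lform t (U w)).

Lemma bmf_cos_lform d (T : measurableType d) (U : T -> V) t b :
  lmeasurable U -> bmf (fun w => cos (lform t (U w) + b)).
Proof.
by move=> mU; apply: bmf_cos; apply: measurable_funD => //; exact: mU.
Qed.

Lemma bmf_trig d (T : measurableType d) (U : T -> V) p :
  lmeasurable U -> trigpoly p -> bmf (fun w => p (U w)).
Proof.
move=> mU; elim=> [c t b|f g _ bf _ bg]; last exact: bmfD.
by apply: bmfM; [exact: bmf_cst|exact: bmf_cos_lform].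
Qed.

(** [f] composed with [U] is a pointwise limit of trigonometric polynomials in [U]: at each point
    all sufficiently large cubes contain the value of [U]. *)
Lemma bmf_continuous d (T : measurableType d) (U : T -> V) (f : V -> R) (M : R) :
  lmeasurable U -> continuous f -> (forall x, `|f x| <= M) ->
  bmf (fun w => f (U w)).
Proof.
move=> mU cf fM; split; last by exists M => w.
have /choice[p hp] : forall k, exists p, trigpoly p /\
    forall x : V, (forall j, `|x 0 j| <= k.+1%:R) -> `|f x - p x| <= k.+1%:R^-1.
  move=> k; have k0 : 0 < k.+1%:R^-1 :> R by rewrite invr_gt0.
  have [p tp [_ fp]] := trig_cube_approx cf fM (ltr0Sn _ k) k0.
  by exists p.
apply: (@measurable_fun_cvg _ _ _ _ (fun k w => p k (U w))).
  by move=> k; have [tp _] := hp k; case: (bmf_trig mU tp).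
move=> w _; apply/cvgrPdist_le => e e0.
near=> k; rewrite (le_trans ((hp k).2 (U w) _))//.
  move=> j; have : \sum_i `|U w 0 i| <= k.+1%:R.
    apply: (@le_trans _ _ k%:R); last by rewrite ler_nat.
    by near: k; exact: nbhs_infty_ger.
  by apply: le_trans; rewrite (bigD1 j)//= lerDl sumr_ge0.
have : (k.+1%:R : R)^-1 < e; last exact: ltW.
near: k; exact: near_infty_natSinv_lt (PosNum e0).
Unshelve. all: by end_near. Qed.

Definition in_cube (L : R) : set V := [set x | forall j, `|x 0 j| <= L].

Definition tight d (T : measurableType d) (P : probability T R) (Z : nat -> T -> V) :=
  forall e, 0 < e -> exists2 L, 0 < L & forall n, exists A : set T,
    [/\ measurable A, (P A <= e%:E)%E & forall w, ~ A w -> in_cube L (Z n w)].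

(** The integrands differ by at most e off [A] and by at most 2 M + 1 on [A], whose mass is at most
    e. *)
Lemma Rint_trig_close d (T : measurableType d) (P : probability T R) (U : T -> V)
  (f p : V -> R) (M L e : R) (A : set T) :
  lmeasurable U -> continuous f -> (forall x, `|f x| <= M) -> trigpoly p ->
  0 < e -> e <= 1 -> (forall x, `|p x| <= M + e) ->
  (forall x, in_cube L x -> `|f x - p x| <= e) ->
  measurable A -> (P A <= e%:E)%E -> (forall w, ~ A w -> in_cube L (U w)) ->
  `|\int[P]_w f (U w) - \int[P]_w p (U w)| <= (2 * M + 2) * e.
Proof.
move=> mU cf fM tp e0 e1 pM fp mA PA AU.
have bf := bmf_continuous mU cf fM.
have bp := bmf_trig mU tp.
have bA := bmf_indic (R := R) mA.
have bh : bmf (fun w => e + (2 * M + 1) * \1_A w).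
  by apply: bmfD; [exact: bmf_cst|apply: bmfM => //; exact: bmf_cst].
apply: (@le_trans _ _ (\int[P]_w (e + (2 * M + 1) * \1_A w))).
  apply: Rint_dist => // w; rewrite indicE.
  have M0 : 0 <= M by rewrite (le_trans (normr_ge0 (f 0)))//.
  case: (boolP (w \in A)) => wA; rewrite ?mulr1 ?mulr0 ?addr0.
    rewrite (le_trans (ler_normB _ _))//.
    by have := fM (U w); have := pM (U w); lra.
  by apply: fp; apply: AU; rewrite notin_setE in wA.
rewrite RintD//; [|exact: bmf_cst|by apply: bmfM => //; exact: bmf_cst].
rewrite Rint_prob_cst RintZ//.
have M0 : 0 <= M by rewrite (le_trans (normr_ge0 (f 0)))//.
have : \int[P]_w \1_A w <= e.
  rewrite /Rintegral integral_indic// setIT -lee_fin fineK//.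
  exact: fin_num_measure.
by set x := \int[P]_w _ => xe; nra.
Qed.

(* Trigonometric polynomials only see the laws of the linear forms, and by
   tightness they suffice to test weak convergence. *)
Lemma weak_cvg_of_cos d (T : measurableType d) (P : probability T R)
  (Z : nat -> T -> V) d' (T' : measurableType d') (Q : probability T' R)
  (W : T' -> V) :
  (forall n, lmeasurable (Z n)) -> lmeasurable W ->
  tight P Z -> tight Q (fun=> W) ->
  (forall t b, \int[P]_w cos (lform t (Z n w) + b) @[n --> \oo] -->
               \int[Q]_w cos (lform t (W w) + b)) ->
  forall f : V -> R, continuous f -> (exists M, forall x, `|f x| <= M) ->
  (\int[P]_w (f (Z n w))%:E @[n --> \oo] --> \int[Q]_w (f (W w))%:E)%E.
Proof.
move=> mZ mW tZ tW cosZW f cf [M fM].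
rewrite (bmf_Rint _ (bmf_continuous mW cf fM)).
under eq_fun do rewrite (bmf_Rint _ (bmf_continuous (mZ _) cf fM)).
apply: cvg_EFin; first exact: nearW.
have trigZW p : trigpoly p ->
    \int[P]_w p (Z n w) @[n --> \oo] --> \int[Q]_w p (W w).
  elim=> [c t b|g h tg ig th ih].
    rewrite (RintZ _ _ (bmf_cos_lform t b mW)).
    under eq_fun do rewrite (RintZ _ _ (bmf_cos_lform t b (mZ _))).
    by apply: cvgMr; exact: cosZW.
  rewrite (RintD _ (bmf_trig mW tg) (bmf_trig mW th)).
  under eq_fun do rewrite (RintD _ (bmf_trig (mZ _) tg) (bmf_trig (mZ _) th)).
  exact: cvgD.
have M0 : 0 <= M by rewrite (le_trans (normr_ge0 (f 0)))//.
apply/cvgrPdist_le => r r0.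
(* Each of the three errors, two from replacing f by p and one from the convergence for p, is at
   most r/3. *)
pose e := Num.min 1 (r / (3 * (2 * M + 2))).
have c0 : 0 < 3 * (2 * M + 2) by rewrite mulr_gt0// ltr_wpDl// mulr_ge0.
have e0 : 0 < e by rewrite lt_min ltr01/= divr_gt0.
have e1 : e <= 1 by rewrite ge_min lexx.
have er : (2 * M + 2) * e <= r / 3.
  have : e <= r / (3 * (2 * M + 2)) by rewrite ge_min lexx orbT.
  by rewrite ler_pdivlMr// ler_pdivlMr//; lra.
have [L1 L10 tZ1] := tZ _ e0; have [L2 L20 tW1] := tW _ e0.
pose L := Num.max L1 L2.
have L0 : 0 < L by rewrite lt_max L10.
have [p tp [pM fp]] := trig_cube_approx cf fM L0 e0.
have /cvgrPdist_le/(_ (r / 3)) := trigZW p tp.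
rewrite divr_gt0// => /(_ isT); apply: filterS => n pn.
have [A [mA PA AZ]] := tZ1 n.
have [A' [mA' PA' AW]] := tW1 0.
have h1 := Rint_trig_close (mZ n) cf fM tp e0 e1 pM fp mA PA
  (fun w Aw j => le_trans (AZ w Aw j) _).
have h2 := Rint_trig_close mW cf fM tp e0 e1 pM fp mA' PA'
  (fun w Aw j => le_trans (AW w Aw j) _).
have {}h1 := le_trans (h1 _) er.
have {}h2 := le_trans (h2 _) er.
set a := \int[Q]_w f (W w) in h2 *; set a' := \int[Q]_w p (W w) in h2 pn *.
set z := \int[P]_w f (Z n w) in h1 *; set z' := \int[P]_w p (Z n w) in h1 pn *.
have {}h1 : `|z - z'| <= r / 3 by apply: h1 => *; rewrite le_max lexx.
have {}h2 : `|a - a'| <= r / 3 by apply: h2 => *; rewrite le_max lexx orbT.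
have -> : a - z = (a - a') + (a' - z') - (z - z') by ring.
rewrite (le_trans (ler_normB _ _))//.
have := ler_normD (a - a') (a' - z').
by lra.
Qed.

(** The events where the sum of the moduli of the coordinates exceeds n decrease to the empty
    set. *)
Lemma tight_cst d (T : measurableType d) (Q : probability T R) (W : T -> V) :
  lmeasurable W -> tight Q (fun=> W).
Proof.
move=> mW e e0.
pose g w := \sum_j `|lform (1 *: delta_mx 0 j) (W w)|.
have mg : measurable_fun setT g.
  apply: measurable_sum => j; apply: measurableT_comp => //; exact: mW.
pose F (n : nat) := g @^-1` `]n%:R, +oo[.
have mF n : measurable (F n).
  by rewrite -[X in measurable X]setTI; exact: mg.
have : Q (F n) @[n --> \oo] --> Q (\bigcap_n F n).
  apply: nonincreasing_cvg_mu => //.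
  - by rewrite ltey_eq fin_num_measure.
  - exact: bigcapT_measurable.
  - move=> n k nk; apply/subsetPset => w; rewrite /F /= !in_itv/= !andbT.
    by apply: le_lt_trans; rewrite ler_nat.
have -> : \bigcap_n F n = set0.
  apply/seteqP; split => // w /(_ (Num.bound (g w)) I).
  rewrite /F /= in_itv/= andbT ltNge => /negP; apply; apply: ltW.
  by apply: archi_boundP; apply: sumr_ge0.
rewrite measure0 => /fine_cvgP[_ /cvgrPdist_le /(_ _ e0)] [n _ hn].
exists n.+1%:R => // _; exists (F n.+1); split => //.
  have := hn n.+1 (leqnSn n); rewrite /= sub0r normrN ger0_norm ?fine_ge0//.
  by rewrite -lee_fin fineK//; exact: fin_num_measure.
move=> w; rewrite /F/= in_itv/= andbT => /negP; rewrite -leNgt => gn j.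
apply: le_trans gn; rewrite /g (bigD1 j)//= -[X in `|X|]mul1r -lform_delta lerDl.
exact: sumr_ge0.
Qed.

Lemma tight_second_moment d (T : measurableType d) (P : probability T R)
  (Z : nat -> T -> V) (C : R) :
  (forall n j, bmf (fun w => Z n w 0 j)) ->
  (forall n, \int[P]_w (\sum_j (Z n w 0 j) ^+ 2) <= C) -> tight P Z.
Proof.
move=> bZ ZC e e0.
have bS n : bmf (fun w => \sum_j (Z n w 0 j) ^+ 2).
  by apply: bmf_sum => j; exact: bmfX.
have C0 : 0 <= C.
  rewrite (le_trans _ (ZC 0))//; apply: Rintegral_ge0 => w _.
  by apply: sumr_ge0 => j _; rewrite sqr_ge0.
(* Chebyshev's inequality; the added 1 keeps [K] positive when [C] is 0. *)
pose K := C / e + 1.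
have K0 : 0 < K by rewrite ltr_wpDl// divr_ge0// ltW.
exists (Num.sqrt K) => [|n]; first by rewrite sqrtr_gt0.
pose g w := \sum_j (Z n w 0 j) ^+ 2.
pose A := g @^-1` `]K, +oo[.
have mA : measurable A by rewrite -[X in measurable X]setTI; exact: (bS n).1.
have bA := bmf_indic (R := R) mA.
exists A; split => //.
  have : \int[P]_w (K * \1_A w) <= \int[P]_w g w.
    apply: Rint_le => //.
      by apply: bmfM => //; exact: bmf_cst.
      exact: bS.
    move=> w; rewrite indicE; case: (boolP (w \in A)).
      by rewrite mulr1 => /set_mem; rewrite /A/= in_itv/= andbT => /ltW.
    by rewrite mulr0 => _; apply: sumr_ge0 => j _; rewrite sqr_ge0.
  rewrite RintZ// => h; have {}h := le_trans h (ZC n).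
  have PE : (P A = (\int[P]_w \1_A w)%:E)%E.
    rewrite /Rintegral integral_indic// setIT fineK//; exact: fin_num_measure.
  rewrite PE lee_fin -(ler_pM2l K0) (le_trans h)// /K mulrDl mul1r divfK ?gt_eqF//.
  by rewrite lerDl ltW.
move=> w; rewrite /A /= in_itv/= andbT => /negP; rewrite -leNgt => gK j.
rewrite -sqrtr_sqr ler_wsqrtr// (le_trans _ gK)// /g (bigD1 j)//= lerDl.
by apply: sumr_ge0 => i _; rewrite sqr_ge0.
Qed.

End weak_convergence.

(** * The delta method *)

Section delta_method.
Context {R : realType} {n : nat}.
Implicit Types x mu : n.-tuple R.

Lemma tdot_ge0 x : 0 <= tdot x x.
Proof. by apply: sumr_ge0 => i _; rewrite -expr2 sqr_ge0. Qed.

Lemma tnorm_ge0 x : 0 <= tnorm x. Proof. exact: sqrtr_ge0. Qed.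

Lemma tnorm_sqr x : tnorm x ^+ 2 = tdot x x.
Proof. by rewrite sqr_sqrtr// tdot_ge0. Qed.

Lemma tnth_tnormalize x i : tnth (tnormalize x) i = (tnorm x)^-1 * tnth x i.
Proof. by rewrite tnth_mktuple. Qed.

Lemma sqr_tnth_le x i : tnth x i ^+ 2 <= tdot x x.
Proof.
rewrite /tdot (bigD1 i)//= -expr2 lerDl; apply: sumr_ge0 => j _.
by rewrite -expr2 sqr_ge0.
Qed.

Lemma norm_tnth_le x i : `|tnth x i| <= tnorm x.
Proof. by rewrite -sqrtr_sqr ler_wsqrtr// sqr_tnth_le. Qed.

(** Also true at x = 0, where both sides vanish. This is why the remainder estimates need no lower
    bound on the norm. *)
Lemma tnorm_tnormalize x i : tnorm x * tnth (tnormalize x) i = tnth x i.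
Proof.
rewrite tnth_tnormalize; have [x0|x0] := eqVneq (tnorm x) 0; last by rewrite mulVKf.
have := norm_tnth_le x i; rewrite x0 mul0r normr_le0 => /eqP ->.
by [].
Qed.

Lemma norm_tnormalize_le1 x i : `|tnth (tnormalize x) i| <= 1.
Proof.
rewrite tnth_tnormalize; have [x0|x0] := eqVneq (tnorm x) 0.
  by rewrite x0 invr0 mul0r normr0 ler01.
have xp : 0 < tnorm x by rewrite lt_def x0 tnorm_ge0.
by rewrite normrM normfV (gtr0_norm xp) ler_pdivrMl// mulr1 norm_tnth_le.
Qed.

Definition tdist2 x y : R := \sum_(i < n) (tnth x i - tnth y i) ^+ 2.

Lemma tdist2_ge0 x y : 0 <= tdist2 x y.
Proof. by apply: sumr_ge0 => i _; rewrite sqr_ge0. Qed.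

Lemma sqr_dist_le_tdist2 x y i : (tnth x i - tnth y i) ^+ 2 <= tdist2 x y.
Proof.
by rewrite /tdist2 (bigD1 i)//= lerDl; apply: sumr_ge0 => j _; rewrite sqr_ge0.
Qed.

Variables (mu : n.-tuple R) (r : R).
Hypothesis mu1 : tdot mu mu = 1.
Hypothesis r0 : 0 < r.
Local Notation m := (tscale r mu).

Lemma norm_unit_tnth_le1 i : `|tnth mu i| <= 1.
Proof. by rewrite -(sqrtr1 R) -mu1; exact: norm_tnth_le. Qed.

Lemma tdot_unit_le x : `|tdot x mu| <= tnorm x.
Proof.
rewrite -sqrtr_sqr ler_wsqrtr// -subr_ge0.
(* Cauchy-Schwarz: the gap is the squared length of the component of x orthogonal to mu. *)
have -> : tdot x x - tdot x mu ^+ 2 =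
  \sum_(i < n) (tnth x i - tdot x mu * tnth mu i) ^+ 2.
  have -> : \sum_(i < n) (tnth x i - tdot x mu * tnth mu i) ^+ 2 =
    \sum_(i < n) (tnth x i * tnth x i + (- (2 * tdot x mu)) * (tnth x i * tnth mu i)
       + tdot x mu ^+ 2 * (tnth mu i * tnth mu i)).
    by apply: eq_bigr => i _; ring.
  rewrite !big_split/= -!mulr_sumr -/(tdot x x) -/(tdot x mu) -/(tdot mu mu) mu1.
  by ring.
by apply: sumr_ge0 => i _; rewrite sqr_ge0.
Qed.

Let tdist2E x : tdist2 x m = tnorm x ^+ 2 - 2 * r * tdot x mu + r ^+ 2.
Proof.
rewrite tnorm_sqr.
have -> : tdist2 x m =
  \sum_(i < n) (tnth x i * tnth x i + (- (2 * r)) * (tnth x i * tnth mu i)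
       + r ^+ 2 * (tnth mu i * tnth mu i)).
  by apply: eq_bigr => i _; rewrite tnth_mktuple; ring.
rewrite !big_split/= -!mulr_sumr -/(tdot x x) -/(tdot x mu) -/(tdot mu mu) mu1.
by ring.
Qed.

(** Both terms are nonnegative, so each is bounded by the squared distance: this controls the error
    of the norm and, to second order, its linearisation. *)
Let tdist2_split x : tdist2 x m = (tnorm x - r) ^+ 2 + 2 * r * (tnorm x - tdot x mu).
Proof. by rewrite tdist2E; ring. Qed.

Lemma tnorm_remainder x : 0 <= tnorm x - tdot x mu <= tdist2 x m / (2 * r).
Proof.
have h := tdot_unit_le x; rewrite ler_norml in h; case/andP: h => _ h.
rewrite subr_ge0 h/= ler_pdivlMr ?mulr_gt0// tdist2_split.
by have := sqr_ge0 (tnorm x - r); lra.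
Qed.

Lemma tnorm_dist_sqr_le x : (tnorm x - r) ^+ 2 <= tdist2 x m.
Proof.
rewrite tdist2_split lerDl mulr_ge0 ?mulr_ge0// ?(ltW r0)//.
by have /andP[] := tnorm_remainder x.
Qed.

Let dlt x := Num.sqrt (tdist2 x m).

Let dlt_sqr x : dlt x ^+ 2 = tdist2 x m.
Proof. by rewrite sqr_sqrtr// tdist2_ge0. Qed.

Lemma tnorm_dist_le x : `|tnorm x - r| <= Num.sqrt (tdist2 x m).
Proof. by rewrite -sqrtr_sqr ler_wsqrtr// tnorm_dist_sqr_le. Qed.

Lemma tnormalize_dist_le x i :
  `|tnth (tnormalize x) i - tnth mu i| <= 2 / r * Num.sqrt (tdist2 x m).
Proof.
rewrite mulrAC ler_pdivlMr// -[X in _ * X](gtr0_norm r0) -normrM.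
(* Both terms on the right are at most |x - r mu|, whence the constant 2/r. *)
have -> : (tnth (tnormalize x) i - tnth mu i) * r =
  (r - tnorm x) * tnth (tnormalize x) i + (tnth x i - tnth m i).
  by rewrite [tnth m i]tnth_mktuple -[tnth x i](tnorm_tnormalize x i); ring.
rewrite (le_trans (ler_normD _ _))// mulr_natl mulr2n lerD//.
  rewrite normrM (le_trans (ler_piMr _ (norm_tnormalize_le1 _ _)))//.
  by rewrite distrC tnorm_dist_le.
by rewrite -sqrtr_sqr ler_wsqrtr// sqr_dist_le_tdist2.
Qed.

Lemma tnormalize_remainder x i :
  `|tnth (tnormalize x) i - tnth mu i - (tnth x i - tnth mu i * tdot x mu) / r| <=
  5 / (2 * r ^+ 2) * tdist2 x m.
Proof.
set e := tnth (tnormalize x) i.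
have -> : e - tnth mu i - (tnth x i - tnth mu i * tdot x mu) / r =
  ((r - tnorm x) * (e - tnth mu i) + tnth mu i * (tdot x mu - tnorm x)) / r.
  by rewrite -(tnorm_tnormalize x i) -/e; field; rewrite gt_eqF.
rewrite normrM normfV (gtr0_norm r0) ler_pdivrMr//.
(* The two numerator terms contribute 2/r and 1/(2r); dividing by r gives 5/(2 r^2). *)
have h1 : `|(r - tnorm x) * (e - tnth mu i)| <= 2 / r * tdist2 x m.
  rewrite normrM -dlt_sqr expr2 mulrCA ler_pM//.
    by rewrite distrC tnorm_dist_le.
  exact: tnormalize_dist_le.
have h2 : `|tnth mu i * (tdot x mu - tnorm x)| <= tdist2 x m / (2 * r).
  have /andP[a b] := tnorm_remainder x.
  rewrite normrM (le_trans (ler_piMl _ (norm_unit_tnth_le1 i)))//.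
  by rewrite distrC ger0_norm.
rewrite (le_trans (ler_normD _ _))// (le_trans (lerD h1 h2))//.
rewrite le_eqVlt; apply/orP; left; apply/eqP; field.
by rewrite gt_eqF.
Qed.

(** The transposed derivative of x |-> (x/|x|, |x|) at r mu, applied to (a, b): the part of a
    orthogonal to mu, over r, plus b mu. *)
Definition delta_dir (a : 'I_n -> R) (b : R) (i : 'I_n) : R :=
  (a i - tnth mu i * \sum_j a j * tnth mu j) / r + b * tnth mu i.

(* The linearisation of x |-> (x/|x|, |x|) at r mu, with a remainder that is
   quadratic on the whole space: this replaces the usual localisation. *)
Lemma delta_remainder (a : 'I_n -> R) (b : R) x :
  `|(\sum_i a i * (tnth (tnormalize x) i - tnth mu i) + b * (tnorm x - r)) -
    \sum_i delta_dir a b i * (tnth x i - tnth m i)| <=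
  ((\sum_i `|a i|) * (5 / (2 * r ^+ 2)) + `|b| / (2 * r)) * tdist2 x m.
Proof.
set s := \sum_j a j * tnth mu j.
have -> : \sum_i delta_dir a b i * (tnth x i - tnth m i) =
  \sum_i a i * ((tnth x i - tnth mu i * tdot x mu) / r) + b * (tdot x mu - r).
  have -> : \sum_i delta_dir a b i * (tnth x i - tnth m i) =
    \sum_i ((r^-1 * (a i * tnth x i) + (- (s / r)) * (tnth x i * tnth mu i))
      + ((- 1) * (a i * tnth mu i) + (s * (tnth mu i * tnth mu i)
      + (b * (tnth x i * tnth mu i) + (- (b * r)) * (tnth mu i * tnth mu i))))).
    apply: eq_bigr => i _; rewrite /delta_dir tnth_mktuple -/s.
    by field; rewrite gt_eqF.
  rewrite !big_split/= -!mulr_sumr -/(tdot x mu) -/(tdot mu mu) mu1 -/s.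
  have -> : \sum_i a i * ((tnth x i - tnth mu i * tdot x mu) / r) =
    \sum_i (r^-1 * (a i * tnth x i) + (- (tdot x mu / r)) * (a i * tnth mu i)).
    by apply: eq_bigr => i _; field; rewrite gt_eqF.
  rewrite !big_split/= -!mulr_sumr -/s.
  by field; rewrite gt_eqF.
have -> : \sum_i a i * (tnth (tnormalize x) i - tnth mu i) + b * (tnorm x - r) -
  (\sum_i a i * ((tnth x i - tnth mu i * tdot x mu) / r) + b * (tdot x mu - r)) =
  \sum_i a i * (tnth (tnormalize x) i - tnth mu i -
                (tnth x i - tnth mu i * tdot x mu) / r) +
  b * (tnorm x - tdot x mu).
  under [in RHS]eq_bigr do rewrite mulrBr.
  by rewrite sumrB; ring.
rewrite (le_trans (ler_normD _ _))// mulrDl lerD//.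
  rewrite (le_trans (ler_norm_sum _ _ _))// -mulrA mulr_suml ler_sum// => i _.
  by rewrite normrM ler_wpM2l// tnormalize_remainder.
have /andP[h1 h2] := tnorm_remainder x.
by rewrite normrM (ger0_norm h1) -mulrA [_^-1 * _]mulrC ler_wpM2l.
Qed.

End delta_method.

Section gaussian_vectors.
Context {R : realType}.

Lemma Rint_normal_law_cos d (T : measurableType d) (Q : probability T R)
  (U : T -> R) (v b : R) : 0 <= v -> measurable_fun setT U ->
  (forall B, measurable B -> Q (U @^-1` B) = normal_law v B) ->
  \int[Q]_w cos (U w + b) = expR (- (v / 2)) * cos b.
Proof.
move=> v0 mU QU.
pose RB := measurableTypeR R.
have mUB : @measurable_fun _ _ T RB setT U by exact: mU.
pose U' : {mfun T >-> RB} := HB.pack_for {mfun T >-> RB} U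
  (@isMeasurableFun.Build _ _ T RB U mUB).
pose h (x : RB) : R := cos ((x : R) + b).
have bc : bmf h by apply: bmf_cos; exact: measurable_funD.
have -> : \int[Q]_w cos (U w + b) = \int[distribution Q U']_x h x.
  rewrite /Rintegral integral_distribution//.
    by apply/measurable_EFinP; case: bc.
  apply: (@bmf_integrable _ _ _ Q (h \o U')).
  exact: (bmf_comp bc).
(* Degenerate directions do occur: the limit covariance is singular along mu. *)
have [v1|v1] := eqVneq v 0.
  have -> : \int[distribution Q U']_x h x = \int[\d_(0 : RB)]_x h x.
    rewrite /Rintegral; congr fine; apply: eq_measure_integral => A mA _.
    by have := QU _ mA; rewrite /normal_law v1 eqxx.
  rewrite /Rintegral integral_dirac//; last by apply/measurable_EFinP; case: bc.
  by rewrite diracT mul1e/= /h add0r v1 mul0r oppr0 expR0 mul1r.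
have -> : \int[distribution Q U']_x h x = \int[normal_prob 0 (Num.sqrt v)]_x h x.
  rewrite /Rintegral; congr fine; apply: eq_measure_integral => A mA _.
  by have := QU _ mA; rewrite /normal_law (negbTE v1).
have s0 : Num.sqrt v != 0 by rewrite gt_eqF// sqrtr_gt0 lt_def v1.
by rewrite /h (Rint_normal_cos _ s0) sqr_sqrtr.
Qed.

End gaussian_vectors.

(** * Moments on the sphere *)

Section closed_boxes.
Context {R : realType} {n : nat}.
Local Notation V := (n.-tuple R).

(** Closed boxes are used because a sign change would turn a half-open interval into one open at the
    other end. *)
Definition cbox (a b : 'I_n -> R) : set V :=
  [set x | forall i, a i <= tnth x i <= b i].

Definition cboxes : set (set V) := [set A | exists a b, A = cbox a b].

Lemma cbox_bigcap a b :
  cbox a b = \bigcap_(i in [set: 'I_n]) ((fun x : V => tnth x i) @^-1` `[a i, b i]).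
Proof.
apply/seteqP; split => x; first by move=> h i _; rewrite /= in_itv/= h.
by move=> h i; have := h i I; rewrite /= in_itv.
Qed.

Lemma measurable_cbox a b : measurable (cbox a b).
Proof.
rewrite cbox_bigcap; apply: fin_bigcap_measurable => // i _.
by rewrite -[X in measurable X]setTI; apply: measurable_tnth.
Qed.

Lemma cboxes_setI : setI_closed cboxes.
Proof.
move=> _ _ [a [b ->]] [a' [b' ->]].
exists (fun i => Num.max (a i) (a' i)), (fun i => Num.min (b i) (b' i)).
apply/seteqP; split => x.
  by move=> [h h'] i; have /andP[h1 h2] := h i; have /andP[h3 h4] := h' i;
    rewrite ge_max le_min h1 h2 h3 h4.
by move=> h; split => i; have := h i; rewrite ge_max le_min => /andP[/andP[h1 h2] /andP[h3 h4]];
  rewrite ?h1 ?h2 ?h3 ?h4.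
Qed.

Definition cube (k : nat) : set V := cbox (fun=> - k%:R) (fun=> k%:R).

Lemma cube_cover : \bigcup_k cube k = setT.
Proof.
apply/seteqP; split => // x _.
exists (Num.bound (\sum_i `|tnth x i|)) => // i; rewrite -ler_norml.
apply: (@le_trans _ _ (\sum_i `|tnth x i|)).
  by rewrite (bigD1 i)//= lerDl sumr_ge0.
by apply: ltW; apply: archi_boundP; exact: sumr_ge0.
Qed.

Lemma measurable_tuple_cboxes : @measurable _ V = <<s cboxes >>.
Proof.
apply/seteqP; split; last first.
  apply: smallest_sub; first exact: sigma_algebra_measurable.
  by move=> _ [a [b ->]]; exact: measurable_cbox.
apply: smallest_sub; first exact: smallest_sigma_algebra.
move=> A; rewrite -bigcup_seq/= => -[i _ [B mB <-]].
pose VB := g_sigma_algebraType cboxes.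
have : measurable_fun setT (fun x : VB => tnth (x : V) i).
  apply: (measurability _ (RGenCInfty.measurableE R)) => _ [_ [a ->] <-].
  rewrite setTI.
  (* A half-space is a countable union of boxes: the other bounds tend to infinity with k. *)
  have -> : (fun x : VB => tnth (x : V) i) @^-1` `[a, +oo[ =
    \bigcup_k cbox (fun j => if j == i then a else - k%:R) (fun=> k%:R).
    apply/seteqP; split => x /=.
      rewrite in_itv/= andbT => ax.
      have : (\bigcup_k cube k) x by rewrite cube_cover.
      move=> [k _ hk]; exists k => // j; have /andP[h1 h2] := hk j.
      have /andP[_ h3] := hk i.
      by case: eqP => [->|_]; rewrite ?ax ?h3 ?h1 ?h2.
    by move=> [k _ /(_ i)]; rewrite eqxx in_itv/= andbT => /andP[].
  apply: bigcupT_measurable => k; apply: sub_sigma_algebra.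
  by exists (fun j => if j == i then a else - k%:R), (fun=> k%:R).
by move=> /(_ measurableT _ mB).
Qed.

Variable lam : {measure set V -> \bar R}.
Hypothesis hlam : is_lebesgue lam.

Let prod_cvg (s : seq 'I_n) (u : 'I_n -> R) :
  \prod_(i <- s) (u i + k.+1%:R^-1) @[k --> \oo] --> \prod_(i <- s) u i.
Proof.
elim: s => [|i s ih].
  by rewrite big_nil; under eq_fun do rewrite big_nil; exact: cvg_cst.
rewrite big_cons; under eq_fun do rewrite big_cons.
apply: cvgM => //; rewrite -[X in _ --> X]addr0.
by apply: cvgD; [exact: cvg_cst|exact: cvg_harmonic].
Qed.

(** A closed box is the decreasing limit of the half-open boxes on which [is_lebesgue] fixes the
    volume. *)
Lemma lebesgue_cbox a b : (forall i, a i <= b i) ->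
  lam (cbox a b) = (\prod_i (b i - a i))%:E.
Proof.
move=> ab.
pose F (k : nat) : set V := [set x | forall i,
  tnth [tuple a i | i < n] i <= tnth x i < tnth [tuple b i + k.+1%:R^-1 | i < n] i].
have FE k : lam (F k) = (\prod_i (b i - a i + k.+1%:R^-1))%:E.
  rewrite /F hlam => [|i]; last by rewrite !tnth_mktuple ler_wpDr.
  by congr EFin; apply: eq_bigr => i _; rewrite !tnth_mktuple addrAC.
have mF k : measurable (F k).
  have -> : F k = \bigcap_(i in [set: 'I_n]) ((fun x : V => tnth x i) @^-1`
      `[a i, (b i + k.+1%:R^-1)%R[).
    apply/seteqP; split => x.
      by move=> h i _; have := h i; rewrite !tnth_mktuple /= in_itv.
    by move=> h i; have := h i I; rewrite !tnth_mktuple /= in_itv.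
  apply: fin_bigcap_measurable => // i _.
  by rewrite -[X in measurable X]setTI; apply: measurable_tnth.
have capF : \bigcap_k F k = cbox a b.
  apply/seteqP; split => x.
    move=> h i; have := h 0 I i; rewrite !tnth_mktuple => /andP[-> _]/=.
    apply/ler_addgt0Pr => e e0; near \oo => k.
    have := h k I i; rewrite !tnth_mktuple => /andP[_ /ltW/le_trans]; apply.
    rewrite lerD2l; apply: ltW; near: k; exact: near_infty_natSinv_lt (PosNum e0).
  move=> h k _ i; rewrite !tnth_mktuple; have /andP[-> h2]/= := h i.
  by rewrite (le_lt_trans h2)// ltrDl invr_gt0.
have : lam \o F @ \oo --> lam (\bigcap_k F k).
  apply: nonincreasing_cvg_mu => //; first by rewrite FE ltry.
    by rewrite capF; exact: measurable_cbox.
  move=> k l kl; apply/subsetPset => x h i; have := h i.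
  rewrite !tnth_mktuple => /andP[-> /lt_le_trans]; apply.
  by rewrite lerD2l lef_pV2 ?posrE// ler_nat.
rewrite capF => /cvg_lim <-//; apply/cvg_lim => //.
rewrite (_ : lam \o F = fun k => (\prod_i (b i - a i + k.+1%:R^-1))%:E); last first.
  by apply/funext => k /=; rewrite FE.
by apply: cvg_EFin; [exact: nearW|exact: prod_cvg].
Unshelve. all: by end_near. Qed.

Lemma lebesgue_cube_fin k : (lam (cube k) < +oo)%E.
Proof.
rewrite lebesgue_cbox ?ltry// => i.
by rewrite (@le_trans _ _ 0) ?oppr_le0 ?ler0n.
Qed.

Variables (s t : 'I_n -> 'I_n) (e : 'I_n -> bool).
Hypotheses (sK : cancel s t) (tK : cancel t s).

Definition signed_perm (x : V) : V := [tuple (-1) ^+ e i * tnth x (s i) | i < n].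

Lemma measurable_signed_perm : measurable_fun setT signed_perm.
Proof.
apply/measurable_fun_tnthP => i.
rewrite (_ : _ \o _ = fun x : V => (-1) ^+ e i * tnth x (s i)); last first.
  by apply/funext => x /=; rewrite tnth_mktuple.
by apply: measurable_funM => //; exact: measurable_tnth.
Qed.

Lemma signed_perm_cbox a b : signed_perm @^-1` (cbox a b) =
  cbox (fun j => let i := t j in if e i then - b i else a i)
       (fun j => let i := t j in if e i then - a i else b i).
Proof.
apply/seteqP; split => x h j.
  have := h (t j); rewrite tnth_mktuple tK /=.
  case: (e _); rewrite ?expr1 ?expr0 ?mulN1r ?mul1r//.
  by rewrite lerNr lerNl andbC.
have := h (s j); rewrite /= sK tnth_mktuple.
case: (e _); rewrite ?expr1 ?expr0 ?mulN1r ?mul1r//.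
by rewrite lerNr lerNl andbC.
Qed.

(* Signed permutations map boxes to boxes, so their invariance needs no change of
   variables; they already determine the moments on the sphere up to order 3. *)
Lemma lebesgue_signed_perm A : measurable A -> lam (signed_perm @^-1` A) = lam A.
Proof.
move=> mA.
rewrite -[LHS]/(pushforward lam signed_perm A).
have mg := measurable_signed_perm.
apply/esym; apply: (measure_unique cboxes cube) => //.
- exact: measurable_tuple_cboxes.
- exact: cboxes_setI.
- by move=> k; exists (fun=> - k%:R), (fun=> k%:R).
- exact: cube_cover.
- move=> _ [a [b ->]].
  rewrite -[RHS]/(lam (signed_perm @^-1` (cbox a b))) signed_perm_cbox.
  have [ab|] := pselect (forall i, a i <= b i).
    rewrite !lebesgue_cbox//; last first.
      by move=> j /=; case: ifP; rewrite ?lerN2.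
    congr EFin; rewrite (reindex_inj (can_inj tK))/=.
    by apply: eq_bigr => j _; case: ifP => // _; rewrite opprK addrC.
  (* If some side is reversed, the volume formula does not apply, but the box and its preimage are
     both empty. *)
  move=> /existsNP[i /negP]; rewrite -ltNge => bai.
  have -> : cbox a b = set0.
    apply/seteqP; split => // x /(_ i) /andP[h1 h2].
    by have := le_lt_trans (le_trans h1 h2) bai; rewrite ltxx.
  rewrite measure0; apply/esym.
  rewrite (_ : cbox _ _ = set0) ?measure0//.
  apply/seteqP; split => // x /(_ (s i)) /=; rewrite sK => /andP[h1 h2].
  have := le_trans h1 h2; case: (e i); rewrite ?lerN2 => h;
    by have := le_lt_trans h bai; rewrite ltxx.
- exact: lebesgue_cube_fin.
Qed.

End closed_boxes.

(** * Symmetries of the cone measure and the first two moments of the law *)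

Section sphere_measure.
Context {R : realType} {d : nat}.
Local Notation V := (d.+1.-tuple R).
Local Notation n := (d.+1).
Variable lam : {measure set V -> \bar R}.
Hypothesis hlam : is_lebesgue lam.

Lemma measurable_tdot (y : V) : measurable_fun setT (fun x : V => tdot x y).
Proof.
apply: measurable_sum => i; apply: measurable_funM => //; exact: measurable_tnth.
Qed.

Lemma measurable_tnorm : measurable_fun setT (fun x : V => tnorm x).
Proof.
apply: (@measurableT_comp _ _ _ _ _ _ (@Num.sqrt R) _ (fun x : V => tdot x x)).
  by apply: continuous_measurable_fun; exact: sqrt_continuous.
by apply: measurable_sum => i; apply: measurable_funM; exact: measurable_tnth.
Qed.

Lemma measurable_tnormalize : measurable_fun setT (fun x : V => tnormalize x).
Proof.
apply/measurable_fun_tnthP => i.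
rewrite (_ : _ \o _ = fun x : V => (tnorm x) `^ (-1) * tnth x i); last first.
  by apply/funext => x /=; rewrite tnth_tnormalize powR_inv1// tnorm_ge0.
apply: measurable_funM; last exact: measurable_tnth.
apply: (@measurableT_comp _ _ _ _ _ _ (fun y : R => y `^ (-1))).
  exact: measurable_powR.
exact: measurable_tnorm.
Qed.

Definition punctured_ball : set V := [set y | (0 < tnorm y) && (tnorm y <= 1)].

Lemma measurable_punctured_ball : measurable punctured_ball.
Proof.
have -> : punctured_ball = (fun x : V => tnorm x) @^-1` `]0, 1].
  by apply/seteqP; split => x; rewrite /= in_itv.
by rewrite -[X in measurable X]setTI; exact: measurable_tnorm.
Qed.

Lemma lebesgue_punctured_ball_fin : (lam punctured_ball < +oo)%E.
Proof.
apply: (@le_lt_trans _ _ (lam (cube 1))); last exact: lebesgue_cube_fin.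
apply: le_measure; rewrite ?inE.
- exact: measurable_punctured_ball.
- exact: measurable_cbox.
- move=> x /andP[_ x1] i; rewrite -ler_norml.
  exact: le_trans (norm_tnth_le _ _) x1.
Qed.

(** The surface measure up to the factor d+1, built as an image measure so that it is a finite
    measure to integrate against. *)
Definition cone_measure : {finite_measure set V -> \bar R} :=
  rimage (m := lam) measurable_punctured_ball lebesgue_punctured_ball_fin
    measurable_tnormalize.
Local Notation sigma := cone_measure.

Lemma surface_measureE A : surface_measure lam A = (n%:R%:E * sigma A)%E.
Proof.
rewrite /surface_measure; congr (_ * lam _)%E.
by apply/seteqP; split => x /= [].
Qed.

Section symmetry.
Variables (s t : 'I_n -> 'I_n) (e : 'I_n -> bool).
Hypotheses (sK : cancel s t) (tK : cancel t s).
Local Notation g := (signed_perm s e).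

Lemma tnorm_signed_perm (x : V) : tnorm (g x) = tnorm x.
Proof.
congr Num.sqrt; rewrite [RHS](reindex_inj (can_inj sK))/=.
apply: eq_bigr => i _; rewrite tnth_mktuple.
by case: (e i); rewrite ?expr1 ?expr0 ?mulN1r ?mul1r// mulrNN.
Qed.

Lemma tnormalize_signed_perm (x : V) : tnormalize (g x) = g (tnormalize x).
Proof.
apply: eq_from_tnth => i; rewrite tnth_tnormalize tnorm_signed_perm.
by rewrite !tnth_mktuple mulrCA.
Qed.

(** Signed permutations preserve the norm and commute with normalisation, so invariance is inherited
    from Lebesgue measure. *)
Lemma cone_measure_signed_perm A : measurable A -> sigma (g @^-1` A) = sigma A.
Proof.
move=> mA; rewrite /sigma /= /rimage.
rewrite -[RHS](lebesgue_signed_perm hlam e sK tK); last first.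
  apply: measurableI; last exact: measurable_punctured_ball.
  by rewrite -[X in measurable X]setTI; exact: measurable_tnormalize.
congr (lam _); apply/seteqP; split => x /=;
  by rewrite /punctured_ball /= tnorm_signed_perm tnormalize_signed_perm.
Qed.

Lemma Rint_cone_signed_perm h : bmf h ->
  \int[sigma]_x h (g x) = \int[sigma]_x h x.
Proof.
move=> bh; have mg : measurable_fun setT (g : V -> V) by exact: measurable_signed_perm.
have := @integral_pushforward _ _ _ _ R g mg sigma setT (EFin \o h) _ _ measurableT.
rewrite preimage_setT => H.
rewrite /Rintegral -[X in fine X = _]H; last 2 first.
- by apply/measurable_EFinP; case: bh.
- by apply: (@bmf_integrable _ _ _ sigma (h \o g)); exact: (bmf_comp bh).
congr fine; apply: eq_measure_integral => A mA _.
exact: cone_measure_signed_perm.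
Qed.

End symmetry.

Lemma measurable_sphere : measurable (sphere : set V).
Proof.
have -> : (sphere : set V) = (fun x : V => tnorm x) @^-1` [set 1].
  by apply/seteqP; split => x.
by rewrite -[X in measurable X]setTI; exact: measurable_tnorm.
Qed.

Definition sph (x : V) : R := \1_sphere x.

(* Cut off outside the sphere so as to be bounded on the whole space. *)
Definition scoord (i : 'I_n) (x : V) : R := sph x * tnth x i.

Lemma sph_sqr x : sph x * sph x = sph x.
Proof. by rewrite /sph indicE; case: (_ \in _); rewrite ?mulr1 ?mulr0. Qed.

Lemma sphE x : sph x = (tnorm x == 1)%:R.
Proof.
rewrite /sph indicE; congr (_%:R : R); congr nat_of_bool.
by apply/idP/eqP => [/set_mem//|h]; exact/mem_set.
Qed.

Lemma norm_scoord_le1 i x : `|scoord i x| <= 1.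
Proof.
rewrite /scoord sphE; case: eqP => [x1|_]; last by rewrite mul0r normr0.
by rewrite mul1r -x1 norm_tnth_le.
Qed.

Lemma bmf_sph : bmf sph.
Proof. by apply: bmf_indic; exact: measurable_sphere. Qed.

Lemma bmf_scoord i : bmf (scoord i).
Proof.
split; last by exists 1 => x; exact: norm_scoord_le1.
by apply: measurable_funM; [case: bmf_sph|exact: measurable_tnth].
Qed.

Lemma scoord_signed_perm s t e (x : V) i : cancel s t ->
  scoord i (signed_perm s e x) = (-1) ^+ e i * scoord (s i) x.
Proof.
move=> sK; rewrite /scoord !sphE (tnorm_signed_perm _ sK) tnth_mktuple.
by rewrite mulrCA.
Qed.

Lemma sum_scoord_sqr x : \sum_i scoord i x ^+ 2 = sph x.
Proof.
rewrite /scoord sphE; case: eqP => [x1|_]; last first.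
  by apply: big1 => i _; rewrite mul0r expr0n.
under eq_bigr do rewrite mul1r expr2.
by rewrite -/(tdot x x) -tnorm_sqr x1 expr1n.
Qed.

Let eqN0 (x : R) : x = - x -> x = 0.
Proof. by lra. Qed.

Let Rint_flip (e : 'I_n -> bool) h : bmf h ->
  (forall x, h (signed_perm id e x) = - h x) -> \int[sigma]_x h x = 0.
Proof.
move=> bh hN; apply: eqN0.
rewrite -[LHS](@Rint_cone_signed_perm id id e)//.
under eq_Rintegral do rewrite hN -mulN1r.
by rewrite RintZ// mulN1r.
Qed.

Lemma Rint_scoord i : \int[sigma]_x scoord i x = 0.
Proof.
apply: (@Rint_flip (pred1 i)) => [|x]; first exact: bmf_scoord.
by rewrite (scoord_signed_perm _ _ _ (t := id))//= eqxx expr1 mulN1r.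
Qed.

Lemma Rint_scoord2_neq i j : i != j -> \int[sigma]_x (scoord i x * scoord j x) = 0.
Proof.
move=> ij; apply: (@Rint_flip (pred1 i)) => [|x].
  by apply: bmfM; exact: bmf_scoord.
rewrite !(scoord_signed_perm _ _ _ (t := id))//= eqxx eq_sym (negbTE ij).
by rewrite expr1 expr0 mul1r mulN1r mulNr.
Qed.

Lemma Rint_scoord3 i j k :
  \int[sigma]_x (scoord i x * scoord j x * scoord k x) = 0.
Proof.
apply: (@Rint_flip predT) => [|x].
  by apply: bmfM; [apply: bmfM|]; exact: bmf_scoord.
by rewrite !(scoord_signed_perm _ _ _ (t := id))//= expr1 !mulN1r mulrNN mulrN.
Qed.

Let swap (i j k : 'I_n) : 'I_n := if k == i then j else if k == j then i else k.

Let swapK i j : cancel (swap i j) (swap i j).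
Proof.
move=> k; rewrite /swap; have [->|ki] := eqVneq k i.
  by rewrite eqxx; case: eqP.
have [->|kj] := eqVneq k j; first by rewrite eqxx.
by rewrite (negbTE ki) (negbTE kj).
Qed.

Let Rint_scoord2_swap i j :
  \int[sigma]_x (scoord i x * scoord i x) = \int[sigma]_x (scoord j x * scoord j x).
Proof.
rewrite -(@Rint_cone_signed_perm (swap i j) (swap i j) (fun=> false))//.
  apply: eq_Rintegral => x _.
  by rewrite (scoord_signed_perm _ _ _ (swapK i j)) expr0 mul1r /swap eqxx.
by apply: bmfM; exact: bmf_scoord.
Qed.

(** Swapping coordinates makes the diagonal moments equal, and they add up to the mass of the sphere
    since the squares of the coordinates sum to 1 there. *)
Lemma Rint_scoord2 i j :
  \int[sigma]_x (scoord i x * scoord j x) =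
  (i == j)%:R * (\int[sigma]_x sph x) / n%:R.
Proof.
have [<-|ij] := eqVneq i j; last by rewrite Rint_scoord2_neq// !mul0r.
have : \int[sigma]_x sph x = n%:R * \int[sigma]_x (scoord i x * scoord i x).
  under eq_Rintegral do rewrite -sum_scoord_sqr.
  rewrite Rint_sum => [|k]; last by apply: bmfX; exact: bmf_scoord.
  rewrite (eq_bigr (fun=> \int[sigma]_x (scoord i x * scoord i x))).
    by rewrite sumr_const card_ord mulr_natl.
  by move=> k _; rewrite (Rint_scoord2_swap i k); under eq_Rintegral do rewrite expr2.
by move=> ->; rewrite mul1r mulrAC divff ?mul1r// pnatr_eq0.
Qed.

Lemma sphere_area_fine : fine (sphere_area lam) = n%:R * \int[sigma]_x sph x.
Proof.
rewrite /sphere_area surface_measureE fineM//; last first.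
  by apply: fin_num_measure; exact: measurable_sphere.
by rewrite /Rintegral integral_indic ?setIT//; exact: measurable_sphere.
Qed.

Variables (mu : V) (rho : R).
Hypothesis mu1 : tdot mu mu = 1.
Hypothesis hrho : 0 < rho < 1.

(** Vanishing off the sphere and written in truncated coordinates, it is bounded everywhere, and its
    products with coordinates expand into moments. *)
Definition C1_density (x : V) : R :=
  sph x + rho * \sum_j tnth mu j * scoord j x.

Lemma bmf_C1_density : bmf C1_density.
Proof.
apply: bmfD; first exact: bmf_sph.
apply: bmfM; first exact: bmf_cst.
by apply: bmf_sum => j; apply: bmfM; [exact: bmf_cst|exact: bmf_scoord].
Qed.

Lemma C1_densityE x : C1_density x = sph x * (1 + rho * tdot x mu).
Proof.
rewrite /C1_density /tdot mulrDr mulr1 mulrCA; congr (_ + _ * _).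
by rewrite mulr_sumr; apply: eq_bigr => j _; rewrite /scoord; ring.
Qed.

Lemma C1_density_ge0 x : 0 <= C1_density x.
Proof.
rewrite C1_densityE sphE; case: eqP => [x1|_]; last by rewrite mul0r.
rewrite mul1r; have := tdot_unit_le mu1 x; rewrite x1 ler_norml => /andP[h1 h2].
by move: hrho => /andP[r0 r1]; nra.
Qed.

Context dT (T : measurableType dT) (P : probability T R) (X : {mfun T >-> V}).
Hypothesis hlaw : has_C1_law P lam mu rho X.
Local Notation omega := (fine (sphere_area lam)).

Let omega_ge0 : 0 <= omega.
Proof.
by rewrite sphere_area_fine mulr_ge0//; apply: Rintegral_ge0 => x _; rewrite sphE.
Qed.

Lemma C1_lawE A : measurable A ->
  distribution P X A =
  (\int[sigma]_(x in A) (n%:R / omega * C1_density x)%:E)%E.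
Proof.
move=> mA; rewrite [LHS](hlaw mA).
have n0 : 0 <= n%:R :> R by [].
have -> : surface_measure lam = mscale (NngNum n0) sigma.
  by apply/funext => B; rewrite surface_measureE.
have bD : bmf (fun x => omega^-1 * C1_density x).
  by apply: bmfM; [exact: bmf_cst|exact: bmf_C1_density].
rewrite ge0_integral_mscale//=; last 3 first.
- by apply: measurableI => //; exact: measurable_sphere.
- apply/measurable_EFinP; apply: measurable_funTS; apply: measurable_funM => //.
  apply: measurable_funD => //; apply: measurable_funM => //; exact: measurable_tdot.
- move=> x [_ x1]; rewrite lee_fin; have := C1_density_ge0 x.
  by rewrite C1_densityE sphE x1 eqxx mul1r => h; rewrite mulr_ge0 ?invr_ge0.
rewrite integral_mkcondr.
have -> : (\int[sigma]_(x in A)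
    ((fun x => (omega^-1 * (1 + rho * tdot x mu))%:E) \_ sphere) x)%E =
  (\int[sigma]_(x in A) (omega^-1 * C1_density x)%:E)%E.
  apply: eq_integral => x _; rewrite patchE C1_densityE sphE; case: ifPn.
    by move=> /set_mem -> ; rewrite eqxx mul1r.
  move=> /negP h; case: eqP => [x1|_]; first by exfalso; apply: h; exact/mem_set.
  by rewrite mul0r mulr0.
rewrite -integralZl//; last first.
  by apply: (integrableS measurableT) => //; exact: bmf_integrable.
by apply: eq_integral => x _; rewrite -EFinM mulrA.
Qed.

Lemma C1_expect h : bmf h ->
  \int[P]_w h (X w) = n%:R / omega * \int[sigma]_x (h x * C1_density x).
Proof.
move=> bh.
have -> : \int[P]_w h (X w) = \int[distribution P X]_x h x.
  rewrite /Rintegral integral_distribution//.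
    by apply/measurable_EFinP; case: bh.
  by apply: (@bmf_integrable _ _ _ P (h \o X)); exact: (bmf_comp bh).
rewrite -RintZ; last by apply: bmfM => //; exact: bmf_C1_density.
rewrite /Rintegral (@integral_density _ _ _ sigma _ (fun x => n%:R / omega * C1_density x))//.
- by congr fine; apply: eq_integral => x _; rewrite mulrCA.
- apply: (bmfM _ _).1; [exact: bmf_cst|exact: bmf_C1_density].
- exact: C1_lawE.
Qed.

(** If the area were 0, its inverse would be 0 as well and the total probability would vanish. *)
Let omega_neq0 : omega != 0.
Proof.
apply/eqP => w0; have := C1_expect (bmf_cst 1).
rewrite Rint_prob_cst w0 invr0 mulr0 mul0r => /eqP.
by rewrite oner_eq0.
Qed.

Let sph_int : n%:R / omega * \int[sigma]_x sph x = 1.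
Proof.
have := omega_neq0; rewrite sphere_area_fine => h.
by rewrite mulrAC mulfV.
Qed.

Lemma C1_sph : \int[P]_w sph (X w) = 1.
Proof.
rewrite C1_expect; last exact: bmf_sph.
rewrite -[RHS]sph_int; congr (_ * _).
have -> : \int[sigma]_x (sph x * C1_density x) =
  \int[sigma]_x (sph x + rho * \sum_j tnth mu j * scoord j x).
  by apply: eq_Rintegral => x _; rewrite -/(C1_density x) C1_densityE mulrA sph_sqr.
have b2 : bmf (fun x => \sum_j tnth mu j * scoord j x).
  by apply: bmf_sum => j; apply: bmfM; [exact: bmf_cst|exact: bmf_scoord].
rewrite RintD; [|exact: bmf_sph|by apply: bmfM => //; exact: bmf_cst].
rewrite RintZ// Rint_sum => [|j]; last first.
  by apply: bmfM; [exact: bmf_cst|exact: bmf_scoord].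
rewrite big1 ?mulr0 ?addr0// => j _.
by rewrite RintZ ?Rint_scoord ?mulr0//; exact: bmf_scoord.
Qed.

Let scoord_sph i x : scoord i x * sph x = scoord i x.
Proof. by rewrite /scoord mulrAC sph_sqr. Qed.

Lemma C1_scoord i : \int[P]_w scoord i (X w) = rho / n%:R * tnth mu i.
Proof.
rewrite C1_expect; last exact: bmf_scoord.
have -> : \int[sigma]_x (scoord i x * C1_density x) =
  \int[sigma]_x (scoord i x + rho * \sum_j tnth mu j * (scoord i x * scoord j x)).
  apply: eq_Rintegral => x _; rewrite /C1_density mulrDr scoord_sph mulrCA.
  by congr (_ + _ * _); rewrite mulr_sumr; apply: eq_bigr => j _; rewrite mulrCA.
have bj j : bmf (fun x => tnth mu j * (scoord i x * scoord j x)).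
  by apply: bmfM; [exact: bmf_cst|apply: bmfM; exact: bmf_scoord].
have b2 : bmf (fun x => \sum_j tnth mu j * (scoord i x * scoord j x)) by exact: bmf_sum.
rewrite RintD; [|exact: bmf_scoord|by apply: bmfM => //; exact: bmf_cst].
rewrite RintZ// Rint_sum// Rint_scoord add0r (bigD1 i)//= big1 ?addr0 => [|j ji].
  rewrite RintZ; last by apply: bmfM; exact: bmf_scoord.
  rewrite Rint_scoord2 eqxx mul1r -[RHS]mul1r -[X in _ = X * _]sph_int.
  by ring.
rewrite RintZ; last by apply: bmfM; exact: bmf_scoord.
by rewrite Rint_scoord2 eq_sym (negbTE ji) !mul0r mulr0.
Qed.

(** The linear part of the density contributes only third moments, which vanish, so the second
    moments are those of the uniform law. *)
Lemma C1_scoord2 i j :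
  \int[P]_w (scoord i (X w) * scoord j (X w)) = (i == j)%:R / n%:R.
Proof.
have bij : bmf (fun x => scoord i x * scoord j x) by apply: bmfM; exact: bmf_scoord.
rewrite (C1_expect bij).
have -> : \int[sigma]_x (scoord i x * scoord j x * C1_density x) =
  \int[sigma]_x (scoord i x * scoord j x +
    rho * \sum_k tnth mu k * (scoord i x * scoord j x * scoord k x)).
  apply: eq_Rintegral => x _; rewrite /C1_density mulrDr; congr (_ + _).
    by rewrite -mulrA scoord_sph.
  rewrite mulrCA; congr (_ * _); rewrite mulr_sumr.
  by apply: eq_bigr => k _; rewrite mulrCA.
have b3 k : bmf (fun x => scoord i x * scoord j x * scoord k x).
  by apply: bmfM => //; exact: bmf_scoord.
have bk k : bmf (fun x => tnth mu k * (scoord i x * scoord j x * scoord k x)).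
  by apply: bmfM => //; exact: bmf_cst.
have b2 : bmf (fun x => \sum_k tnth mu k * (scoord i x * scoord j x * scoord k x)).
  exact: bmf_sum.
rewrite RintD//; last by apply: bmfM => //; exact: bmf_cst.
rewrite RintZ// Rint_sum// big1 ?mulr0 ?addr0 => [|k _]; last first.
  by rewrite RintZ// Rint_scoord3 mulr0.
rewrite Rint_scoord2 -[RHS]mul1r -[X in _ = X * _]sph_int.
by ring.
Qed.

End sphere_measure.

(** * The estimators *)

Lemma cvgD_lim0 (R : realType) (f g : nat -> R) (l : R) :
  f N @[N --> \oo] --> (0 : R) -> g N @[N --> \oo] --> l ->
  f N + g N @[N --> \oo] --> l.
Proof. by move=> hf hg; rewrite -[l]add0r; exact: cvgD. Qed.

Section estimators.
Context {R : realType} {d : nat}.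
Local Notation V := (d.+1.-tuple R).
Local Notation n := (d.+1).
Variable lam : {measure set V -> \bar R}.
Hypothesis hlam : is_lebesgue lam.
Variables (mu : V) (rho : R).
Hypothesis mu1 : tdot mu mu = 1.
Hypothesis hrho : 0 < rho < 1.
Context {dT : measure_display} {T : measurableType dT}.
Variables (P : probability T R) (X : nat -> {RV P >-> V}).
Hypothesis hind : mutually_independent P (fun i => (X i : T -> _)).
Hypothesis hlaw : forall i, has_C1_law P lam mu rho (X i).

Let r : R := rho / n%:R.
Local Notation m := (tscale r mu).

Let n0 : 0 < n%:R :> R. Proof. by rewrite ltr0n. Qed.
Let rho0 : 0 < rho. Proof. by case/andP: hrho. Qed.
Let r0 : 0 < r. Proof. exact: divr_gt0. Qed.
Let r1 : r <= 1.
Proof.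
rewrite /r ler_pdivrMr// mul1r; case/andP: hrho => _ /ltW/le_trans; apply.
by rewrite ler1n.
Qed.

Let mX k : measurable_fun setT (X k : T -> V).
Proof. exact: measurable_funP. Qed.

Definition centered i k w := scoord i (X k w) - r * tnth mu i.

Let bcentered i : bmf (fun x : V => scoord i x - r * tnth mu i).
Proof. by apply: bmfB; [exact: bmf_scoord|exact: bmf_cst]. Qed.

Lemma bmf_centered i k : bmf (centered i k).
Proof. exact: (bmf_comp (bcentered i) (mX k)). Qed.

Lemma norm_centered_le i k w : `|centered i k w| <= 2.
Proof.
rewrite (le_trans (ler_normB _ _))// -[leRHS]/(1 + 1) lerD ?norm_scoord_le1//.
rewrite normrM (gtr0_norm r0).
by rewrite (le_trans (ler_piMr (ltW r0) (norm_unit_tnth_le1 mu1 i))).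
Qed.

Lemma Rint_centered i k : \int[P]_w centered i k w = 0.
Proof.
rewrite RintB; [|exact: (bmf_comp (bmf_scoord i) (mX k))|exact: bmf_cst].
by rewrite (C1_scoord hlam mu1 hrho (hlaw k)) Rint_prob_cst subrr.
Qed.

Lemma Rint_centered2 i j k :
  \int[P]_w (centered i k w * centered j k w) =
  (i == j)%:R / n%:R - r ^+ 2 * (tnth mu i * tnth mu j).
Proof.
have bs l : bmf (fun w => scoord l (X k w)) := bmf_comp (bmf_scoord l) (mX k).
have -> : \int[P]_w (centered i k w * centered j k w) =
  \int[P]_w (scoord i (X k w) * scoord j (X k w) +
    ((- (r * tnth mu i)) * scoord j (X k w) +
     ((- (r * tnth mu j)) * scoord i (X k w) + r ^+ 2 * (tnth mu i * tnth mu j)))).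
  by apply: eq_Rintegral => w _; rewrite /centered; ring.
have bz c l : bmf (fun w => c * scoord l (X k w)) by apply: bmfM => //; exact: bmf_cst.
have bc c : bmf (fun _ : T => c : R) := bmf_cst c.
rewrite RintD; [|exact: bmfM|by apply: bmfD => //; exact: bmfD].
rewrite RintD//; last exact: bmfD.
rewrite RintD// !RintZ// Rint_prob_cst.
rewrite (C1_scoord2 hlam mu1 hrho (hlaw k)) !(C1_scoord hlam mu1 hrho (hlaw k)) -/r.
by ring.
Qed.

Lemma centered_indep i : mutually_independent P (centered i).
Proof.
exact: (mutually_independent_comp (f := fun x : V => scoord i x - r * tnth mu i)
  (bcentered i).1 hind).
Qed.

(** Almost surely equal to [X k w], but bounded everywhere; [sample_mean_ae] transfers the results
    back. *)
Definition truncated k w : V := [tuple scoord i (X k w) | i < n].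

Local Notation Xb := (sample_mean truncated).

Lemma tnth_Xb N w i : (0 < N)%N ->
  tnth (Xb N w) i - tnth m i = psum (centered i) N w / N%:R.
Proof.
move=> N0; rewrite !tnth_mktuple /psum /centered sumrB sumr_const card_ord.
under eq_bigr do rewrite tnth_mktuple.
rewrite mulrBl -(mulr_natr (r * _)) mulfK ?pnatr_eq0 -?lt0n// mulrC.
by [].
Qed.

Lemma tdist2_Xb N w : (0 < N)%N ->
  tdist2 (Xb N w) m = \sum_i (psum (centered i) N w / N%:R) ^+ 2.
Proof. by move=> N0; apply: eq_bigr => i _; rewrite tnth_Xb. Qed.

Lemma bmf_tnth_Xb N i : bmf (fun w => tnth (Xb N w) i).
Proof.
have -> : (fun w => tnth (Xb N w) i) =
    fun w => N%:R^-1 * \sum_(k < N) scoord i (X k w).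
  apply/funext => w; rewrite tnth_mktuple; congr (_ * _).
  by apply: eq_bigr => k _; rewrite tnth_mktuple.
apply: bmfM; first exact: bmf_cst.
by apply: bmf_sum => k; exact: (bmf_comp (bmf_scoord i) (mX k)).
Qed.

Lemma bmf_tdist2_Xb N : bmf (fun w => tdist2 (Xb N w) m).
Proof.
apply: bmf_sum => i; apply: bmfX; apply: bmfB; first exact: bmf_tnth_Xb.
exact: bmf_cst.
Qed.

Lemma Rint_tdist2_Xb N : (0 < N)%N ->
  \int[P]_w tdist2 (Xb N w) m <= 4 * n%:R / N%:R.
Proof.
move=> N0; have NR : 0 < N%:R :> R by rewrite ltr0n.
under eq_Rintegral do rewrite tdist2_Xb//.
have bp i : bmf (psum (centered i) N) by apply: bmf_sum => k; exact: bmf_centered.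
rewrite Rint_sum => [|i]; last first.
  by apply: bmfX; apply: bmfM => //; exact: bmf_cst.
apply: (@le_trans _ _ (\sum_(i < n) (4 / N%:R))); last first.
  by rewrite sumr_const card_ord -[_ *+ n]mulr_natr mulrAC.
apply: ler_sum => i _.
have -> : \int[P]_w ((psum (centered i) N w / N%:R) ^+ 2) =
  N%:R ^- 2 * \int[P]_w (psum (centered i) N w ^+ 2).
  rewrite -RintZ; last exact: bmfX.
  by apply: eq_Rintegral => w _; rewrite expr_div_n mulrC.
have := Rint_psum2_le (fun k => (bmf_centered i k).1) (centered_indep i)
  (norm_centered_le i) (Rint_centered i) N.
rewrite ler_pdivrMl ?exprn_gt0// => h; rewrite (le_trans h)//.
rewrite le_eqVlt; apply/orP; left; apply/eqP; field.
by rewrite gt_eqF.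
Qed.

Lemma Xb_strong_law : {ae P, forall w, tdist2 (Xb N w) m @[N --> \oo] --> (0 : R)}.
Proof.
have h i := strong_law (fun k => (bmf_centered i k).1) (centered_indep i)
  (norm_centered_le i) (Rint_centered i).
have {}h : {ae P, forall w, forall i : 'I_n,
    psum (centered i) N w / N%:R @[N --> \oo] --> (0 : R)}.
  exact: filter_forall.
apply: filterS h => w hw.
have : \sum_i (psum (centered i) N w / N%:R) ^+ 2 @[N --> \oo] --> (0 : R).
  elim: (index_enum _) => [|i s ih].
    by under eq_fun do rewrite big_nil; exact: cvg_cst.
  have hi : (psum (centered i) N w / N%:R) ^+ 2 @[N --> \oo] --> (0 : R).
    have -> : (fun N => (psum (centered i) N w / N%:R) ^+ 2) =
      (fun N => psum (centered i) N w / N%:R) \* (fun N => psum (centered i) N w / N%:R).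
      by apply/funext => N; rewrite expr2.
    by rewrite -(mulr0 (0 : R)); apply: cvgM; exact: hw.
  by under eq_fun do rewrite big_cons; exact: cvgD_lim0.
apply: cvg_trans; apply: near_eq_cvg; near=> N.
by rewrite tdist2_Xb//; near: N; exact: nbhs_infty_gt.
Unshelve. all: by end_near. Qed.

(** A deterministic function of the point, so that the pathwise bounds of the delta method apply
    before taking expectations. *)
Definition scaled_error (N : nat) (x : V) : 'rV[R]_(n + 1) :=
  row_mx (Num.sqrt N%:R *: (trow (tnormalize x) - trow mu))
         (Num.sqrt N%:R * (n%:R * tnorm x - rho))%:M.

Lemma scaled_error_lshift N x i :
  scaled_error N x 0 (lshift 1 i) = Num.sqrt N%:R * (tnth (tnormalize x) i - tnth mu i).
Proof. by rewrite /scaled_error row_mxEl !mxE. Qed.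

Lemma scaled_error_rshift N x (i : 'I_1) :
  scaled_error N x 0 (rshift n i) = Num.sqrt N%:R * (n%:R * (tnorm x - r)).
Proof.
rewrite /scaled_error row_mxEr !mxE ord1 eqxx mulr1n; congr (_ * _).
by rewrite mulrBr /r mulrC [X in _ = _ - X]mulrC divfK ?gt_eqF// mulrC.
Qed.

Lemma lform_scaled_error t N x : lform t (scaled_error N x) = Num.sqrt N%:R *
  (\sum_i t 0 (lshift 1 i) * (tnth (tnormalize x) i - tnth mu i) +
   t 0 (rshift n 0) * n%:R * (tnorm x - r)).
Proof.
rewrite lformE big_split_ord/= big_ord1 mulrDr scaled_error_rshift; congr (_ + _).
  by rewrite mulr_sumr; apply: eq_bigr => i _; rewrite scaled_error_lshift mulrAC mulrA.
by ring.
Qed.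

Lemma lmeasurable_scaled_error N (x : T -> V) : measurable_fun setT x ->
  lmeasurable (fun w => scaled_error N (x w)).
Proof.
move=> mx t; under eq_fun do rewrite lform_scaled_error.
apply: measurable_funM => //; apply: measurable_funD.
  apply: measurable_sum => i; apply: measurable_funM => //.
  apply: measurable_funD => //.
  apply: (measurableT_comp (measurable_tnth i)).
  exact: (measurableT_comp measurable_tnormalize).
apply: measurable_funM => //; apply: measurable_funD => //.
exact: (measurableT_comp measurable_tnorm).
Qed.

Lemma measurable_sample_mean (Y : nat -> T -> V) N :
  (forall k, measurable_fun setT (Y k)) -> measurable_fun setT (sample_mean Y N).
Proof.
move=> mY; apply/measurable_fun_tnthP => i.
rewrite (_ : _ \o _ = fun w => N%:R^-1 * \sum_(k < N) tnth (Y k w) i); last first.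
  by apply/funext => w /=; rewrite tnth_mktuple.
apply: measurable_funM => //; apply: measurable_sum => k.
exact: (measurableT_comp (measurable_tnth i)).
Qed.

Lemma measurable_Xb N : measurable_fun setT (Xb N).
Proof.
apply: measurable_sample_mean => k; apply/measurable_fun_tnthP => i.
rewrite (_ : _ \o _ = fun w => scoord i (X k w)); last first.
  by apply/funext => w /=; rewrite tnth_mktuple.
exact: (bmf_comp (bmf_scoord i) (mX k)).1.
Qed.

Let sqrtN_sqr (N : nat) : Num.sqrt N%:R ^+ 2 = N%:R :> R.
Proof. by rewrite sqr_sqrtr. Qed.

Lemma scaled_error_sqr_le N x : \sum_j scaled_error N x 0 j ^+ 2 <=
  N%:R * ((4 / r ^+ 2 * n%:R + n%:R ^+ 2) * tdist2 x m).
Proof.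
rewrite big_split_ord/= big_ord1 scaled_error_rshift.
under eq_bigr do rewrite scaled_error_lshift exprMn sqrtN_sqr.
rewrite -mulr_sumr exprMn sqrtN_sqr -mulrDr ler_wpM2l// mulrDl lerD//.
  apply: (@le_trans _ _ (\sum_(i < n) (4 / r ^+ 2 * tdist2 x m))).
    apply: ler_sum => i _; rewrite -real_normK ?num_real//.
    have h := tnormalize_dist_le mu1 r0 x i.
    rewrite (le_trans (lerXn2r 2 _ _ h)) ?nnegrE//.
      by rewrite mulr_ge0 ?sqrtr_ge0// divr_ge0// ltW.
    rewrite exprMn sqr_sqrtr ?tdist2_ge0// expr_div_n.
    by rewrite (_ : 2 ^+ 2 = 4 :> R)//; ring.
  by rewrite sumr_const card_ord -[_ *+ n]mulr_natr mulrAC.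
by rewrite exprMn ler_wpM2l ?sqr_ge0// tnorm_dist_sqr_le.
Qed.

Lemma bmf_scaled_error_Xb N j : bmf (fun w => scaled_error N (Xb N w) 0 j).
Proof.
split.
  have := @lmeasurable_scaled_error N (Xb N) (measurable_Xb N) (1 *: delta_mx 0 j).
  by under eq_fun do rewrite lform_delta mul1r.
have [_ [M hM]] := bmf_tdist2_Xb N.
exists (Num.sqrt (N%:R * ((4 / r ^+ 2 * n%:R + n%:R ^+ 2) * M))) => w.
rewrite -sqrtr_sqr ler_wsqrtr//.
apply: (@le_trans _ _ (\sum_j scaled_error N (Xb N w) 0 j ^+ 2)).
  by rewrite (bigD1 j)//= lerDl; apply: sumr_ge0 => i _; rewrite sqr_ge0.
apply: (le_trans (scaled_error_sqr_le _ _)); rewrite ler_wpM2l// ler_wpM2l//.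
  by rewrite addr_ge0 ?sqr_ge0// mulr_ge0// divr_ge0// sqr_ge0.
by rewrite (le_trans _ (hM w))// ler_norm.
Qed.

Lemma tight_scaled_error : tight P (fun N w => scaled_error N (Xb N w)).
Proof.
set K := 4 / r ^+ 2 * n%:R + n%:R ^+ 2.
have K0 : 0 <= K by rewrite addr_ge0 ?sqr_ge0// mulr_ge0// divr_ge0// sqr_ge0.
apply: (@tight_second_moment _ _ _ _ _ _ (K * (4 * n%:R))).
  exact: bmf_scaled_error_Xb.
(* For N = 0 the factor sqrt 0 makes the whole error vanish. *)
move=> N; have [->|N0] := posnP N.
  under eq_Rintegral => w _.
    rewrite big1 => [|j _]; last first.
      apply/eqP; rewrite sqrf_eq0; apply/eqP.
      by rewrite /scaled_error sqrtr0 scale0r mul0r raddf0 row_mx0 mxE.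
    over.
  by rewrite Rint_prob_cst !mulr_ge0.
have NR : 0 < N%:R :> R by rewrite ltr0n.
have bt := bmf_tdist2_Xb N.
apply: (@le_trans _ _ (\int[P]_w ((N%:R * K) * tdist2 (Xb N w) m))).
  apply: Rint_le => [||w].
  - by apply: bmf_sum => j; apply: bmfX; exact: bmf_scaled_error_Xb.
  - by apply: bmfM => //; exact: bmf_cst.
  - by rewrite -mulrA; exact: scaled_error_sqr_le.
rewrite RintZ//; have := Rint_tdist2_Xb N0; rewrite ler_pdivlMr// => h.
by rewrite mulrAC [leLHS]mulrC ler_wpM2l// mulrC.
Qed.

(** * Linear forms of the error: central limit theorem and limit variance *)

Section direction.
Variable t : 'rV[R]_(n + 1).
Let a i := t 0 (lshift 1 i).
Let b := t 0 (rshift n 0).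
Let u := delta_dir mu r a (b * n%:R).

Definition limit_var : R :=
  n%:R / rho ^+ 2 * (\sum_i a i ^+ 2 - (\sum_i a i * tnth mu i) ^+ 2) +
  (n%:R - rho ^+ 2) * b ^+ 2.

Definition delta_proj k w := \sum_i u i * centered i k w.

Lemma bmf_delta_proj k : bmf (delta_proj k).
Proof.
by apply: bmf_sum => i; apply: bmfM; [exact: bmf_cst|exact: bmf_centered].
Qed.

Lemma norm_delta_proj_le k w : `|delta_proj k w| <= \sum_i `|u i| * 2.
Proof.
rewrite (le_trans (ler_norm_sum _ _ _))//; apply: ler_sum => i _.
by rewrite normrM ler_wpM2l// norm_centered_le.
Qed.

Lemma Rint_delta_proj k : \int[P]_w delta_proj k w = 0.
Proof.
rewrite Rint_sum => [|i]; last first.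
  by apply: bmfM; [exact: bmf_cst|exact: bmf_centered].
apply: big1 => i _; rewrite RintZ ?Rint_centered ?mulr0//; exact: bmf_centered.
Qed.

Lemma delta_proj_indep : mutually_independent P delta_proj.
Proof.
have bf : bmf (fun x : V => \sum_i u i * (scoord i x - r * tnth mu i)).
  by apply: bmf_sum => i; apply: bmfM => //; exact: bmf_cst.
exact: (mutually_independent_comp bf.1 hind).
Qed.

(** This is |u|^2/n - r^2 <u,mu>^2 with n = d+1. Here <u,mu> = b n depends on the radial weight
    only, and a enters |u|^2 only through its part orthogonal to mu, so the two blocks decouple. *)
Lemma Rint_delta_proj2 k : \int[P]_w (delta_proj k w ^+ 2) = limit_var.
Proof.
have bc i j : bmf (fun w => centered i k w * centered j k w).
  by apply: bmfM; exact: bmf_centered.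
have bcz c i j : bmf (fun w => c * (centered i k w * centered j k w)).
  by apply: bmfM => //; exact: bmf_cst.
have -> : \int[P]_w (delta_proj k w ^+ 2) =
  \int[P]_w (\sum_i \sum_j u i * u j * (centered i k w * centered j k w)).
  apply: eq_Rintegral => w _; rewrite expr2 /delta_proj mulr_suml.
  apply: eq_bigr => i _; rewrite mulr_sumr; apply: eq_bigr => j _.
  by ring.
rewrite Rint_sum => [|i]; last by apply: bmf_sum => j.
have -> : \sum_i \int[P]_w (\sum_j u i * u j * (centered i k w * centered j k w)) =
  \sum_i (u i ^+ 2 / n%:R - (r ^+ 2 * \sum_j u j * tnth mu j) * (u i * tnth mu i)).
  apply: eq_bigr => i _; rewrite Rint_sum//.
  under eq_bigr do rewrite RintZ// Rint_centered2 mulrBr.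
  rewrite sumrB; congr (_ - _).
    rewrite (bigD1 i)//= big1 ?addr0 => [|j ji]; first by rewrite eqxx mul1r expr2.
    by rewrite eq_sym (negbTE ji) mul0r mulr0.
  rewrite mulr_sumr mulr_suml; apply: eq_bigr => j _.
  by ring.
rewrite sumrB -mulr_suml -mulr_sumr.
set s := \sum_j a j * tnth mu j.
have umu : \sum_j u j * tnth mu j = b * n%:R.
  have -> : \sum_j u j * tnth mu j =
    \sum_j (r^-1 * (a j * tnth mu j) + (b * n%:R - s / r) * (tnth mu j * tnth mu j)).
    by apply: eq_bigr => j _; rewrite /u /delta_dir -/s; field; rewrite gt_eqF.
  by rewrite big_split/= -!mulr_sumr -/(tdot mu mu) mu1 -/s; field; rewrite gt_eqF.
have u2 : \sum_j u j ^+ 2 = (\sum_j a j ^+ 2 - s ^+ 2) / r ^+ 2 + (b * n%:R) ^+ 2.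
  have -> : \sum_j u j ^+ 2 =
    \sum_j (r ^- 2 * a j ^+ 2 + (2 * (b * n%:R - s / r) / r * (a j * tnth mu j) +
      (b * n%:R - s / r) ^+ 2 * (tnth mu j * tnth mu j))).
    by apply: eq_bigr => j _; rewrite /u /delta_dir -/s; field; rewrite gt_eqF.
  rewrite !big_split/= -!mulr_sumr -/(tdot mu mu) mu1 -/s.
  by field; rewrite gt_eqF.
rewrite umu u2 /limit_var -/s /r; field.
by rewrite (gt_eqF rho0) addrC natr1 pnatr_eq0.
Qed.

Let C := (\sum_i `|a i|) * (5 / (2 * r ^+ 2)) + `|b * n%:R| / (2 * r).

Let C_ge0 : 0 <= C.
Proof.
have r2 : 0 <= 2 * r by rewrite mulr_ge0// ltW.
apply: addr_ge0; last exact: divr_ge0.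
apply: mulr_ge0; first exact: sumr_ge0.
by apply: divr_ge0 => //; apply: mulr_ge0 => //; exact: sqr_ge0.
Qed.

Lemma lform_scaled_error_remainder N w : (0 < N)%N ->
  `|lform t (scaled_error N (Xb N w)) - (Num.sqrt N%:R)^-1 * psum delta_proj N w| <=
  (Num.sqrt N%:R * C) * tdist2 (Xb N w) m.
Proof.
move=> N0; have NR : 0 < N%:R :> R by rewrite ltr0n.
have sN : 0 < Num.sqrt N%:R :> R by rewrite sqrtr_gt0.
have -> : (Num.sqrt N%:R)^-1 * psum delta_proj N w =
  Num.sqrt N%:R * \sum_i u i * (tnth (Xb N w) i - tnth m i).
  have -> : \sum_i u i * (tnth (Xb N w) i - tnth m i) = psum delta_proj N w / N%:R.
    under eq_bigr do rewrite tnth_Xb// mulrA.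
    rewrite -mulr_suml; congr (_ / _); rewrite /psum /delta_proj exchange_big/=.
    by apply: eq_bigr => i _; rewrite mulr_sumr.
  rewrite [X in _ / X](_ : N%:R = Num.sqrt N%:R ^+ 2); last by rewrite sqrtN_sqr.
  by field; rewrite gt_eqF.
rewrite lform_scaled_error -mulrBr normrM (gtr0_norm sN) -[leRHS]mulrA ler_pM2l//.
exact: delta_remainder.
Qed.

Lemma scaled_error_cos_cvg c :
  \int[P]_w cos (lform t (scaled_error N (Xb N w)) + c) @[N --> \oo] -->
  expR (- (limit_var / 2)) * cos c.
Proof.
have h := cos_psum_cvg (b := c) (fun k => (bmf_delta_proj k).1) delta_proj_indep norm_delta_proj_le
  Rint_delta_proj Rint_delta_proj2.
(* Cosine is 1-Lipschitz and the remainder has mean at most sqrt N * C * 4n/N, which is of order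
   1/sqrt N. *)
have hd : \int[P]_w cos (lform t (scaled_error N (Xb N w)) + c) -
  \int[P]_w cos ((Num.sqrt N%:R)^-1 * psum delta_proj N w + c) @[N --> \oo] --> (0 : R).
  apply/norm_cvg0P.
  have hs : C * (4 * n%:R) * (Num.sqrt N%:R)^-1 @[N --> \oo] --> (0 : R).
    exact: cvg_inv_sqrt.
  apply: (squeeze_cvgr _ (cvg_cst 0) hs); near=> N.
  have N0 : (0 < N)%N by near: N; exact: nbhs_infty_gt.
  have NR : 0 < N%:R :> R by rewrite ltr0n.
  have sN : 0 < Num.sqrt N%:R :> R by rewrite sqrtr_gt0.
  rewrite normr_ge0/=.
  have bt : bmf (fun w => (Num.sqrt N%:R * C) * tdist2 (Xb N w) m).
    by apply: bmfM; [exact: bmf_cst|exact: bmf_tdist2_Xb].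
  have bpsum : bmf (psum delta_proj N) by apply: bmf_sum => k; exact: bmf_delta_proj.
  apply: (@le_trans _ _ (\int[P]_w ((Num.sqrt N%:R * C) * tdist2 (Xb N w) m))).
    apply: Rint_dist => //.
    - exact/bmf_cos_lform/lmeasurable_scaled_error/measurable_Xb.
    - apply: bmf_cos; apply: measurable_funD => //; apply: measurable_funM => //.
      by case: bpsum.
    move=> w; rewrite (le_trans (cos_lipschitz _ _))//.
    by rewrite opprD addrACA subrr addr0; exact: lform_scaled_error_remainder.
  rewrite RintZ; last exact: bmf_tdist2_Xb.
  apply: (@le_trans _ _ (Num.sqrt N%:R * C * (4 * n%:R / N%:R))).
    by rewrite ler_wpM2l ?Rint_tdist2_Xb// mulr_ge0// ltW.
  rewrite le_eqVlt; apply/orP; left; apply/eqP.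
  rewrite [X in _ / X](_ : N%:R = Num.sqrt N%:R ^+ 2); last by rewrite sqrtN_sqr.
  by field; rewrite gt_eqF.
by have := cvgD_lim0 hd h; under eq_fun do rewrite subrK.
Unshelve. all: by end_near. Qed.

Lemma limit_var_ge0 : 0 <= limit_var.
Proof. by rewrite -(Rint_delta_proj2 0); apply: Rintegral_ge0 => w _; rewrite sqr_ge0. Qed.

Lemma dvarE : (t *m (block_mx
    (n%:R / rho ^+ 2 *: (1%:M - (trow mu)^T *m trow mu)) 0 0 ((n%:R - rho ^+ 2)%:M)
    : 'M[R]_(n + 1)) *m t^T) 0 0 = limit_var.
Proof.
rewrite -[t]hsubmxK tr_row_mx mul_row_block !mulmx0 addr0 add0r mul_row_col mxE.
set A := lsubmx t; set B := rsubmx t.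
have aE i : A 0 i = a i by rewrite mxE.
have BE : B 0 0 = b by rewrite mxE.
congr (_ + _); last first.
  rewrite mul_mx_scalar -scalemxAl mxE; congr (_ * _).
  by rewrite mxE big_ord1 [X in _ * X]mxE BE expr2.
rewrite -scalemxAr -scalemxAl mxE; congr (_ * _).
rewrite mulmxBr mulmx1 mulmxBl mxE [X in _ + X]mxE; congr (_ - _).
  by rewrite mxE; apply: eq_bigr => i _; rewrite [X in _ * X]mxE aE expr2.
have muA : trow mu *m A^T = (A *m (trow mu)^T)^T by rewrite trmx_mul trmxK.
rewrite mulmxA -[_ *m trow mu *m _]mulmxA muA mxE big_ord1 [X in _ * X]mxE expr2.
have -> : (A *m (trow mu)^T) 0 0 = \sum_i a i * tnth mu i.
  by rewrite mxE; apply: eq_bigr => i _; rewrite aE !mxE.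
by [].
Qed.

End direction.

Lemma ae_sphere : {ae P, forall w, forall k, tnorm (X k w) = 1}.
Proof.
apply: ae_foralln => k.
have mS : measurable ((X k : T -> V) @^-1` sphere).
  by rewrite -[X in measurable X]setTI; apply: mX => //; exact: measurable_sphere.
exists (~` ((X k : T -> V) @^-1` sphere)); split => //.
- exact: measurableC.
- have h := C1_sph hlam mu1 hrho (hlaw k).
  have PS : P ((X k : T -> V) @^-1` sphere) = 1%E.
    rewrite -[RHS]/(1%:E) -h /Rintegral fineK; last first.
      by apply: integrable_fin_num => //; apply: bmf_integrable;
        exact: (bmf_comp bmf_sph (mX k)).
    transitivity (\int[P]_x (\1_((X k : T -> V) @^-1` sphere) x)%:E)%E.
      by rewrite integral_indic// setIT.
    by apply: eq_integral => x _; rewrite /sph !indicE.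
  by apply: (eq_trans (probability_setC P mS)); rewrite [X in (_ - X)%E]PS subee.
Qed.

Lemma sample_mean_ae : {ae P, forall w, forall N,
  sample_mean (fun i => (X i : T -> _)) N w = Xb N w}.
Proof.
apply: filterS ae_sphere => w Xw N; apply: eq_from_tnth => i.
rewrite !tnth_mktuple; congr (_ * _); apply: eq_bigr => k _.
by rewrite tnth_mktuple /scoord sphE Xw eqxx mul1r.
Qed.

End estimators.

Theorem theorem2 (R : realType) (d : nat) (hd : (0 < d)%N)
  (lam : {measure set (d.+1.-tuple R) -> \bar R}) (hlam : is_lebesgue lam)
  (mu : d.+1.-tuple R) (hmu : mu \in sphere) (rho : R) (hrho : 0 < rho < 1)
  (dT : measure_display) (T : measurableType dT) (P : probability T R)
  (X : nat -> {RV P >-> d.+1.-tuple R})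
  (hind : mutually_independent P (fun i => (X i : T -> _)))
  (hlaw : forall i, has_C1_law P lam mu rho (X i)) :
  let Xbar := sample_mean (fun i => (X i : T -> _)) in
  let muhat := fun n w => tnormalize (Xbar n w) in
  let rhohat := fun n w => d.+1%:R * tnorm (Xbar n w) in
  let sigma2_mu := d.+1%:R / rho ^+ 2 in
  let sigma2_rho := d.+1%:R - rho ^+ 2 in
  let Sigma : 'M[R]_(d.+1 + 1) :=
    block_mx (sigma2_mu *: (1%:M - (trow mu)^T *m trow mu)) 0 0 (sigma2_rho%:M) in
  let Z := fun n w => (row_mx (Num.sqrt n%:R *: (trow (muhat n w) - trow mu))
                              (Num.sqrt n%:R * (rhohat n w - rho))%:M
                       : 'rV[R]_(d.+1 + 1)) in
  (* (i) strong consistency *)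
  {ae P, forall w, trow (muhat n w) @[n --> \oo] --> trow mu /\
                   rhohat n w @[n --> \oo] --> rho}
  /\
  (* (ii) asymptotic normality: convergence in distribution to N_{d+2}(0, Sigma) *)
  (forall (dQ : measure_display) (Om : measurableType dQ) (Q : probability Om R)
          (W : Om -> 'rV[R]_(d.+1 + 1)),
     is_gaussian_vector Q Sigma W ->
     forall f : 'rV[R]_(d.+1 + 1) -> R, continuous f ->
       (exists M : R, forall x, `|f x| <= M) ->
       (\int[P]_w (f (Z n w))%:E)%E @[n --> \oo] --> (\int[Q]_w (f (W w))%:E)%E).
Proof.
move=> Xbar muhat rhohat sigma2_mu sigma2_rho Sigma Z.
have mu1 : tdot mu mu = 1.
  by rewrite -tnorm_sqr (set_mem hmu) expr1n.
have rho0 : 0 < rho by case/andP: hrho.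
pose r := rho / d.+1%:R.
have r0 : 0 < r by rewrite divr_gt0// ltr0n.
have eXb := sample_mean_ae hlam mu1 hrho hlaw.
split.
  apply: filterS2 (Xb_strong_law hlam mu1 hrho hind hlaw) eXb => w h e.
  have hd2 : tdist2 (Xbar N w) (tscale r mu) @[N --> \oo] --> (0 : R).
    by under eq_fun do rewrite /Xbar e; exact: h.
  (* Both estimation errors are pathwise at most a constant times the distance from the sample mean
     to r mu. *)
  have hs (K : R) : K * Num.sqrt (tdist2 (Xbar N w) (tscale r mu)) @[N --> \oo] --> (0 : R).
    rewrite -(mulr0 K); apply: cvgM; first exact: cvg_cst.
    rewrite -(sqrtr0 R).
    exact: (cvg_comp _ (@Num.sqrt R) hd2 (@sqrt_continuous R 0)).
  split.
    apply/cvgrPdist_le => eps eps0.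
    have /cvgrPdist_le/(_ _ eps0) := hs (2 / r).
    apply: filterS => N; rewrite sub0r normrN => hN.
    rewrite [X in X <= _]mx_normrE; apply: bigmax_le => [|[i j] _]; first exact: ltW.
    rewrite /= !mxE distrC (le_trans (tnormalize_dist_le mu1 r0 _ _))//.
    by rewrite (le_trans (ler_norm _) hN).
  apply/cvgrPdist_le => eps eps0.
  have /cvgrPdist_le/(_ _ eps0) := hs d.+1%:R.
  apply: filterS => N; rewrite sub0r normrN => hN.
  have -> : rho - rhohat N w = d.+1%:R * (r - tnorm (Xbar N w)).
    by rewrite mulrBr /r mulrC divfK.
  rewrite (le_trans _ hN)// !normrM ler_wpM2l// distrC.
  by rewrite (le_trans (tnorm_dist_le mu1 r0 _))// ler_norm.
move=> dQ Om Q W gW f cf fM.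
have mW : lmeasurable W by move=> t; have [] := gW t.
have mXb N := measurable_Xb X N.
have mZ N : lmeasurable (fun w => scaled_error mu rho N (sample_mean (truncated X) N w)).
  exact: lmeasurable_scaled_error.
have cosZ t c : \int[P]_w cos (lform t (scaled_error mu rho n (sample_mean (truncated X) n w)) + c)
    @[n --> \oo] --> \int[Q]_w cos (lform t (W w) + c).
  (* By [dvarE] the limit variance in direction t is the quadratic form of [Sigma], so the Gaussian
     side has the same explicit value. *)
  rewrite (Rint_normal_law_cos (v := limit_var mu rho t)).
  - exact: (scaled_error_cos_cvg hlam mu1 hrho hind hlaw).
  - exact: (limit_var_ge0 hlam mu1 hrho hlaw).
  - exact: mW.
  - by move=> B mB; have [_ /(_ B mB)] := gW t; rewrite -(dvarE mu rho t).
have key := weak_cvg_of_cos mZ mW (tight_scaled_error hlam mu1 hrho hind hlaw)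
  (tight_cst Q mW) cosZ cf fM.
suff -> : (fun n => (\int[P]_w (f (Z n w))%:E)%E) =
  (fun n => (\int[P]_w (f (scaled_error mu rho n (sample_mean (truncated X) n w)))%:E)%E) by [].
have [M hM] := fM.
(* The two errors differ only on the null event where some observation is off the sphere. *)
apply/funext => N; apply: ae_eq_integral => //.
- apply/measurable_EFinP.
  have mXbar : measurable_fun setT (Xbar N).
    by apply: measurable_sample_mean => k; exact: measurable_funP.
  exact: (bmf_continuous (lmeasurable_scaled_error mu rho N mXbar) cf hM).1.
- apply/measurable_EFinP; exact: (bmf_continuous (mZ N) cf hM).1.
- by apply: filterS eXb => w e _; rewrite /Z /muhat /rhohat /Xbar e.
Qed.
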